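(* Let $\mathfrak{a}$ be a finite-dimensional Lie subalgebra of the Virasoro algebra $\hat{\mathfrak{d}}$. Then $\dim(\mathfrak{a})\leqslant 4$. Moreover: (i) If $\dim(\mathfrak{a})=1$, then $\mathfrak{a}=\mathbb{C}X$ for a nonzero $X\in\hat{\mathfrak{d}}$. (ii) If $\dim(\mathfrak{a})=2$, then $\mathfrak{a}$ is equal to one of the following subalgebras: - $\mathbb{C}X\oplus\mathbb{C}K$ for some nonzero $X\in\mathfrak{d}$; or - $\mathrm{span}_{\mathbb{C}}\{L_0+\alpha K, L_m\}$ for some $\alpha\in\mathbb{C}$ and $m\in\mathbb{Z}^{\times}$; or - $\mathrm{span}_{\mathbb{C}}\{P_{\mu}(t)\partial+\alpha K, Q_{\mu}(t)\partial+\beta_0 K\}$ for some $\mu\in\Sigma$ and $\alpha\in\mathbb{C}$, where $\beta_0\in\mathbb{C}$ is determined by the bracket in $\hat{\mathfrak{d}}$: $[P_{\mu}(t)\partial, Q_{\mu}(t)\partial]=\lambda Q_{\mu}(t)\partial+\lambda\beta_0 K$ with $\lambda\in\mathbb{C}^{\times}$. (iii) If $\dim(\mathfrak{a})=3$, then - $\mathfrak{a}=\mathrm{span}_{\mathbb{C}}\{L_0+\frac{1}{24}(m^2-1)K, L_{-m}, L_m\}$ for some $m\in\mathbb{Z}^{\times}$; or - $\mathfrak{a}=\mathfrak{z}(m)\oplus\mathbb{C}K$ for some $m\in\mathbb{Z}^{\times}$; or - $\mathfrak{a}=\mathfrak{s}(\mu)\oplus\mathbb{C}K$ for some $\mu\in\Sigma$.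 (iv) If $\dim(\mathfrak{a})=4$, then $\mathfrak{a}=\mathrm{span}_{\mathbb{C}}\{L_0,L_{-m},L_m,K\}$ for some $m\in\mathbb{Z}^{\times}$.
   Context: $\mathbb{N}$ is the set of positive integers, $\mathbb{Z}^{\times}=\mathbb{Z}\setminus\{0\}$, $\mathbb{C}^{\times}=\mathbb{C}\setminus\{0\}$. $\mathfrak{d}$ is the centreless Virasoro algebra over $\mathbb{C}$, i.e. the Lie algebra of derivations of $\mathbb{C}[t^{\pm1}]$; with $\partial=t\frac{d}{dt}$, every element of $\mathfrak{d}$ is uniquely $F(t)\partial$ with $F(t)\in\mathbb{C}[t^{\pm1}]$, and $\mathfrak{d}$ has basis $L_m=-t^m\partial$ ($m\in\mathbb{Z}$) with $[L_m,L_n]=(m-n)L_{m+n}$ in $\mathfrak{d}$. The Virasoro algebra is $\hat{\mathfrak{d}}=\mathfrak{d}\oplus\mathbb{C}K$ (as a vector space), with $K$ central and $[L_m,L_n]=(m-n)L_{m+n}+\frac{1}{12}(m^3-m)\delta_{m,-n}K$. Elements and subspaces of $\mathfrak{d}$ are regarded as elements and subspaces of $\hat{\mathfrak{d}}$ via this vector space decomposition. For $m\in\mathbb{Z}^{\times}$, $\mathfrak{z}(m)=\mathrm{span}_{\mathbb{C}}\{\partial,t^{m}\partial\}$. For $n,k\in\mathbb{N}$ with $n\geqslant k$, let $\Gamma(n,k)=\{(r_1,\ldots,r_n)\in\mathbb{N}^k\times\{-1\}^{n-k} : r_1+\cdots+r_n\geqslant k\}$. For $\mathbf{r}=(r_1,\ldots,r_n)\in\Gamma(n,k)$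 put $|\mathbf{r}|=r_1+\cdots+r_n$, $V(\mathbf{r})=\{(a_1,\ldots,a_n)\in\mathbb{C}^n : \sum_{j=1}^n r_ja_j^i=0 \text{ for } i=1,\ldots,n-1\}$, and $V(\mathbf{r})^{\times}=V(\mathbf{r})\cap(\mathbb{C}^{\times})^n$. Let $\Sigma=\{(n,k,\mathbf{r},\mathbf{a}) : n,k\in\mathbb{N},\ n\geqslant k,\ \mathbf{r}\in\Gamma(n,k),\ \mathbf{a}\in V(\mathbf{r})^{\times}\}$. For $\mu=(n,k,\mathbf{r},\mathbf{a})\in\Sigma$ let $P_{\mu}(t)=(t-a_1)\cdots(t-a_n)\in\mathbb{C}[t]$, $Q_{\mu}(t)=t^{-|\mathbf{r}|}(t-a_1)^{r_1+1}\cdots(t-a_k)^{r_k+1}\in\mathbb{C}[t^{\pm1}]$, and $\mathfrak{s}(\mu)=\mathrm{span}_{\mathbb{C}}\{P_{\mu}(t)\partial,Q_{\mu}(t)\partial\}\subseteq\mathfrak{d}$. *)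

(* Defs.v *)
From HB Require Import structures.
From mathcomp Require Import all_boot all_order all_algebra.
From mathcomp Require Import finmap monalg.
From mathcomp Require Import classical_sets reals complex.

Set Implicit Arguments.
Unset Strict Implicit.
Unset Printing Implicit Defensive.

Import Order.TTheory GRing.Theory Num.Theory.

Local Open Scope ring_scope.

(* Laurent polynomials C[t^{+-1}], as finitely supported functions int -> C:
   [F@_m] is the coefficient of t^m and [<< c *g m >>] is c t^m.  The library's
   product on [{malg C[K]}] asks for a monoid K without nontrivial units, so
   the convolution product over the additive group int is set up here.        *)
Definition laurent (C : comNzRingType) : Type := {malg C[int]}.

HB.instance Definition _ (C : comNzRingType) := GRing.Lmodule.on (laurent C).

Section LaurentRing.
Context {C : comNzRingType}.
Implicit Types (f g h : laurent C) (m n : int) (c d : C).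

Definition lterm c m : laurent C := << c *g m >>.

Fact lmul_key : unit. Proof. by []. Qed.

(* Locked, so that unification does not unfold products. *)
Definition lmul f g : laurent C := locked_with lmul_key
  (\sum_(m <- msupp f) \sum_(n <- msupp g) lterm (f@_m * g@_n) (m + n)).

Lemma lmulE f g :
  lmul f g = \sum_(m <- msupp f) \sum_(n <- msupp g) lterm (f@_m * g@_n) (m + n).
Proof. by rewrite /lmul unlock. Qed.

Lemma lterm0 m : lterm 0 m = 0.
Proof. exact: monalgU0. Qed.

Lemma ltermD m c d : lterm (c + d) m = lterm c m + lterm d m.
Proof. exact: monalgUD. Qed.

Lemma ltermZ c d m : c *: lterm d m = lterm (c * d) m.
Proof. by apply/malgP => k; rewrite mcoeffZ !mcoeffU mulrnAr. Qed.

Lemma laurentE f : f = \sum_(m <- msupp f) lterm f@_m m.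
Proof. exact: monalgE. Qed.

Lemma lmulEw (d1 d2 : {fset int}) f g :
  (msupp f `<=` d1)%fset -> (msupp g `<=` d2)%fset ->
  lmul f g = \sum_(m <- d1) \sum_(n <- d2) lterm (f@_m * g@_n) (m + n).
Proof.
move=> le1 le2; rewrite lmulE.
rewrite (big_fset_incl _ le1) /=; last first.
  move=> m _ /mcoeff_outdom E; rewrite big1 // => n _.
  by rewrite E mul0r lterm0.
apply: eq_bigr => m _.
rewrite (big_fset_incl _ le2) //= => n _ /mcoeff_outdom E.
by rewrite E mulr0 lterm0.
Qed.

Lemma lmulC f g : lmul f g = lmul g f.
Proof.
rewrite !lmulE exchange_big /=; apply: eq_bigr => m _; apply: eq_bigr => n _.
by rewrite mulrC addrC.
Qed.

Lemma lmulDl f g h : lmul (f + g) h = lmul f h + lmul g h.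
Proof.
have le1 := fsubsetUl (msupp f) (msupp g).
have le2 := fsubsetUr (msupp f) (msupp g).
rewrite (lmulEw (msuppD_le f g) (fsubset_refl (msupp h))).
rewrite (lmulEw le1 (fsubset_refl (msupp h))).
rewrite (lmulEw le2 (fsubset_refl (msupp h))) -big_split /=.
apply: eq_bigr => m _; rewrite -big_split /=; apply: eq_bigr => n _.
by rewrite mcoeffD mulrDl ltermD.
Qed.

Lemma lmulDr f g h : lmul f (g + h) = lmul f g + lmul f h.
Proof. by rewrite !(lmulC f) lmulDl. Qed.

Lemma lmul0 f : lmul 0 f = 0.
Proof. by rewrite lmulE msupp0 big_nil. Qed.

Lemma lmul_suml (I : Type) (s : seq I) (F : I -> laurent C) g :
  lmul (\sum_(i <- s) F i) g = \sum_(i <- s) lmul (F i) g.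
Proof. exact: (big_morph (fun f => lmul f g) (fun _ _ => lmulDl _ _ _) (lmul0 g)). Qed.

Lemma lmul_sumr (I : Type) (s : seq I) (F : I -> laurent C) g :
  lmul g (\sum_(i <- s) F i) = \sum_(i <- s) lmul g (F i).
Proof. by rewrite lmulC lmul_suml; apply: eq_bigr => i _; rewrite lmulC. Qed.

Lemma lmulUU c d m n : lmul (lterm c m) (lterm d n) = lterm (c * d) (m + n).
Proof.
rewrite (lmulEw (@msuppU_le _ _ m c) (@msuppU_le _ _ n d)).
by rewrite !big_seq_fset1 !mcoeffUU.
Qed.

Lemma lmulA : associative lmul.
Proof.
move=> f g h; rewrite (laurentE f) (laurentE g) (laurentE h).
rewrite !lmul_suml; apply: eq_bigr => m _.
rewrite [LHS]lmul_sumr [lmul _ (\sum_(_ <- msupp g) _)]lmul_sumr lmul_suml.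
apply: eq_bigr => n _.
rewrite [lmul (lterm _ n) _]lmul_sumr [LHS]lmul_sumr [RHS]lmul_sumr.
apply: eq_bigr => p _.
by rewrite !lmulUU mulrA addrA.
Qed.

Lemma lmul1 : left_id (lterm 1 0) lmul.
Proof.
move=> f; rewrite {1}(laurentE f) lmul_sumr [RHS]laurentE.
by apply: eq_bigr => m _; rewrite lmulUU mul1r add0r.
Qed.

Lemma lone_neq0 : lterm 1 0 != 0.
Proof. by rewrite /lterm monalgU_eq0 oner_neq0. Qed.

HB.instance Definition _ := GRing.Zmodule_isComNzRing.Build (laurent C)
  lmulA lmulC lmul1 lmulDl lone_neq0.

Lemma lscaleAl c f g : c *: (f * g) = (c *: f) * g.
Proof.
have E h : c *: h = lterm c 0 * h.
  rewrite [RHS](_ : _ = lmul (lterm c 0) h) // (laurentE h) lmul_sumr scaler_sumr.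
  by apply: eq_bigr => m _; rewrite ltermZ lmulUU add0r.
by rewrite !E mulrA.
Qed.

HB.instance Definition _ :=
  GRing.Lmodule_isLalgebra.Build C (laurent C) lscaleAl.
HB.instance Definition _ := GRing.Lalgebra_isComAlgebra.Build C (laurent C).

End LaurentRing.

Section Virasoro.
Context {C : fieldType}.
Implicit Types (f g h : laurent C) (m n : int) (c : C).

Definition lmon m : laurent C := lterm 1 m.

(* The derivation t d/dt of C[t^{+-1}]. *)
Definition lder f : laurent C := \sum_(m <- msupp f) lterm (f@_m * m%:~R) m.

(* The Laurent polynomial F stands for the derivation F(t) lder, with
   lder = t d/dt, and this is the commutator of F(t) lder and G(t) lder.     *)
Definition witt_bracket f g : laurent C := f * lder g - g * lder f.

Definition vir : Type := (laurent C * C^o)%type.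

HB.instance Definition _ := GRing.Lmodule.on vir.

Definition vec f : vir := (f, 0).
Definition vK : vir := (0, 1).
Definition L m : vir := vec (- lmon m).

Definition vir_cocycle f g : C :=
  \sum_(m <- msupp f) (m ^+ 3 - m)%:~R / 12%:R * (f@_m * g@_(- m)).

Definition vir_bracket (x y : vir) : vir :=
  (witt_bracket x.1 y.1, vir_cocycle x.1 y.1).

Lemma mcoeff_lder f m : (lder f)@_m = f@_m * m%:~R.
Proof.
rewrite /lder raddf_sum /=.
have [fm|fm] := boolP (m \in msupp f).
  rewrite (big_fsetD1 m) //= mcoeffUU big_seq big1 ?addr0 // => n.
  by rewrite !inE mcoeffU => /andP[/negPf-> _]; rewrite mulr0n.
rewrite (mcoeff_outdom fm) mul0r big_seq big1 // => n nf.
by rewrite mcoeffU; case: eqP fm nf => // -> /negPf->.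
Qed.

Lemma lder_linear : linear lder.
Proof.
move=> c f g; apply/malgP => m.
by rewrite mcoeff_lder !(mcoeffD, mcoeffZ) !mcoeff_lder mulrDl mulrA.
Qed.

HB.instance Definition _ :=
  GRing.isLinear.Build C (laurent C) (laurent C) _ lder lder_linear.

Lemma lder_lmon m : lder (lmon m) = lterm m%:~R m.
Proof.
apply/malgP => n; rewrite mcoeff_lder !mcoeffU.
by case: eqP => [->|_]; rewrite ?mul1r // mul0r.
Qed.

Lemma lderM f g : lder (f * g) = lder f * g + f * lder g.
Proof.
rewrite (laurentE f) (laurentE g) mulr_suml !raddf_sum /= !mulr_suml -big_split.
apply: eq_bigr => m _ /=.
rewrite [X in lder X]mulr_sumr [X in _ = X + _]mulr_sumr [X in _ = _ + X]mulr_sumr.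
rewrite raddf_sum -big_split /=.
apply: eq_bigr => n _.
have E c k : lder (lterm c k) = lterm (c * k%:~R) k.
  by rewrite -[c in LHS]mulr1 -ltermZ linearZ /= lder_lmon ltermZ.
rewrite [lterm _ _ * lterm _ _ in LHS]lmulUU !E.
rewrite [X in _ = X + _]lmulUU [X in _ = _ + X]lmulUU -ltermD.
by rewrite rmorphD /= mulrDr !mulrA; congr (lterm (_ + _) _); rewrite mulrAC.
Qed.

Lemma witt_bracketE f g h :
  witt_bracket f g * lder h
  = f * lder (g * lder h) - g * lder (f * lder h).
Proof.
have E (T : comNzRingType) (u u' v v' w w' : T) :
    (u * v' - v * u') * w = u * (v' * w + v * w') - v * (u' * w + u * w').
  rewrite !mulrDr mulrBl opprD !mulrA (mulrC v u) addrACA.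
  by rewrite (subrr (u * v * w')) addr0.
by rewrite /witt_bracket (lderM g) (lderM f); apply: E.
Qed.

Lemma vir_cocycleEw (d : {fset int}) f g : (msupp f `<=` d)%fset ->
  vir_cocycle f g
  = \sum_(m <- d) (m ^+ 3 - m)%:~R / 12%:R * (f@_m * g@_(- m)).
Proof.
move=> le; rewrite /vir_cocycle (big_fset_incl _ le) //= => m _.
by move=> /mcoeff_outdom ->; rewrite mul0r mulr0.
Qed.

Lemma vir_bracket_linearl (z : vir) : linear (vir_bracket^~ z).
Proof.
move=> c [x a] [y b]; case: z => z e; congr pair => /=.
  rewrite /witt_bracket linearP /= mulrDl mulrDr scalerBr -scalerAl -scalerAr.
  by rewrite opprD addrACA.
have le : (msupp (c *: x + y)%R `<=` msupp x `|` msupp y)%fset.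
  exact: fsubset_trans (msuppD_le _ _) (fsetSU _ (msuppZ_le _ _)).
rewrite (vir_cocycleEw _ le) (vir_cocycleEw _ (fsubsetUl _ (msupp y))).
rewrite (vir_cocycleEw _ (fsubsetUr (msupp x) _)).
rewrite scaler_sumr -big_split /=; apply: eq_bigr => m _.
rewrite mcoeffD mcoeffZ mulrDl mulrDr; congr (_ + _).
by rewrite -(mulrA c) mulrCA.
Qed.

Lemma vir_bracket_linearr (z : vir) : linear (vir_bracket z).
Proof.
move=> c [x a] [y b]; case: z => z e; congr pair => /=.
  rewrite /witt_bracket linearP /= mulrDl mulrDr scalerBr -scalerAl -scalerAr.
  by rewrite opprD addrACA.
rewrite /vir_cocycle scaler_sumr -big_split /=; apply: eq_bigr => m _.
by rewrite mcoeffD mcoeffZ !mulrDr; congr (_ + _); rewrite !(mulrCA _ c).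
Qed.

Lemma vir_bracketLL m n :
  vir_bracket (L m) (L n)
  = (m - n)%:~R *: L (m + n)
    + ((m == - n)%:R * ((m ^+ 3 - m)%:~R / 12%:R)) *: vK.
Proof.
have wE : witt_bracket (- lmon m) (- lmon n)
          = (m - n)%:~R *: (- lmon (m + n)).
  rewrite /witt_bracket !(linearN lder) /= !lder_lmon !mulrNN ?scalerN.
  rewrite [X in X - _]lmulUU [X in _ - X]lmulUU !mul1r [(n + m)%R]addrC.
  apply/malgP => k; rewrite mcoeffN mcoeffB mcoeffZ !mcoeffU rmorphB /=.
  by case: eqP => _; rewrite ?mulr1 ?mulr0 ?subr0 ?oppr0 // opprB.
have cE : vir_cocycle (- lmon m) (- lmon n)
          = (m == - n)%:R * ((m ^+ 3 - m)%:~R / 12%:R).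
  rewrite /vir_cocycle msuppN msuppU oner_eq0 big_seq_fset1 !mcoeffN !mcoeffU.
  by rewrite mulrNN eqxx mul1r mulrC (eq_sym n) eqr_oppLR.
rewrite /vir_bracket wE cE; congr pair => /=.
  by rewrite scaler0 addr0.
by rewrite scaler0 add0r [_ *: _]mulr1.
Qed.

Lemma vir_bracketKl (x : vir) : vir_bracket vK x = 0.
Proof.
by rewrite /vir_bracket /witt_bracket linear0 mul0r mulr0 subr0 /vir_cocycle
           msupp0 big_nil.
Qed.

Lemma vir_bracketKr (x : vir) : vir_bracket x vK = 0.
Proof.
rewrite /vir_bracket /witt_bracket linear0 mul0r mulr0 subr0 /vir_cocycle /=.
by congr pair; apply: big1 => m _; rewrite mcoeff0 !mulr0.
Qed.

End Virasoro.
Arguments vir : clear implicits.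

Section Subspaces.
Local Open Scope classical_set_scope.

Definition lspan (C : pzRingType) (V : lmodType C) (s : seq V) : set V :=
  [set x | exists c : 'I_(size s) -> C, x = \sum_(i < size s) c i *: s`_i].

Definition lfree (C : pzRingType) (V : lmodType C) (s : seq V) : Prop :=
  forall c : 'I_(size s) -> C,
    \sum_(i < size s) c i *: s`_i = 0 -> forall i, c i = 0.

Definition has_dim (C : pzRingType) (V : lmodType C) (A : set V) (d : nat) :
    Prop :=
  exists s : seq V, [/\ size s = d, lfree s & A = lspan s].

Definition is_direct_sum (C : pzRingType) (V : lmodType C) (A A1 A2 : set V) :
    Prop :=
  A1 `&` A2 = [set 0] /\ A = [set x + y | x in A1 & y in A2].

Definition is_lie_subalgebra (C : fieldType) (A : set (vir C)) : Prop :=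
  submod_closed (mem A) /\ forall x y, A x -> A y -> A (vir_bracket x y).

End Subspaces.

Section SolvableSubalgebras.
Local Open Scope classical_set_scope.
Context {C : fieldType}.

Definition wt (n : nat) (r : 'rV[int]_n) : int := \sum_j r 0 j.

(* The components r_1, ..., r_k are the entries of index j < k. *)
Definition Gamma (n k : nat) : set 'rV[int]_n :=
  [set r : 'rV[int]_n | [/\ forall j : 'I_n, (j < k)%N -> 0 < r 0 j,
               forall j : 'I_n, (k <= j)%N -> r 0 j = -1
             & k%:Z <= wt r]].
Arguments Gamma : clear implicits.

Definition Vr (n : nat) (r : 'rV[int]_n) : set 'rV[C]_n :=
  [set a : 'rV[C]_n | forall i : nat, (1 <= i <= n.-1)%N ->
             \sum_j (r 0 j)%:~R * a 0 j ^+ i = 0].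

Definition Vr_unit (n : nat) (r : 'rV[int]_n) : set 'rV[C]_n :=
  Vr r `&` [set a : 'rV[C]_n | forall j, a 0 j != 0].

Record Sigma := MkSigma {
  sg_n : nat;
  sg_k : nat;
  sg_r : 'rV[int]_sg_n;
  sg_a : 'rV[C]_sg_n;
  sg_n_gt0 : (0 < sg_n)%N;
  sg_k_gt0 : (0 < sg_k)%N;
  sg_k_le_n : (sg_k <= sg_n)%N;
  sg_rP : Gamma sg_n sg_k sg_r;
  sg_aP : Vr_unit sg_r sg_a
}.

Definition P_ (mu : Sigma) : laurent C :=
  \prod_(j < sg_n mu) (lmon 1 - (sg_a mu ord0 j)%:A).

(* The exponents r_j + 1 are positive for j < k. *)
Definition Q_ (mu : Sigma) : laurent C :=
  lmon (- wt (sg_r mu)) *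
  \prod_(j < sg_n mu | (j < sg_k mu)%N)
     (lmon 1 - (sg_a mu ord0 j)%:A) ^+ absz (sg_r mu ord0 j + 1)%R.

Definition z_ (m : int) : set (vir C) := lspan [:: vec 1; vec (lmon m)].

Definition s_ (mu : Sigma) : set (vir C) :=
  lspan [:: vec (P_ mu); vec (Q_ mu)].

End SolvableSubalgebras.
Arguments Sigma : clear implicits.

(* Main.v *)
(* The highest exponents occurring in a subalgebra of the Witt algebra are closed
   under sums of distinct members, and bounded if the subalgebra is finite
   dimensional; so they form one of {m}, {0, m}, {-m, 0, m}, and likewise for
   the lowest exponents.  Comparing the two sets, either the subalgebra has
   dimension at most 1, or it is spanned by monomials, or it is spanned by P of
   exponents in [0, n] and Q of exponents in [-w, n] with [P, Q] = l Q.  In the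
   last case, comparing orders of vanishing at the zeros of P Q shows that P has
   simple zeros a_j and Q = t^{-w} prod (t - a_j)^(r_j + 1) with
   r_j a_j P'(a_j) = l, and Lagrange interpolation of t^(i-1) at the a_j gives
   sum_j r_j a_j^i = 0.  The bound k <= |r| holds since t^w (P - Q) is a
   polynomial of degree w = |r| vanishing at the k zeros of Q.  A subalgebra of
   the Virasoro algebra either contains K or is a graph over its image in the
   Witt algebra, and then brackets determine its K-components. *)
Require Import Defs.
From HB Require Import structures.
From mathcomp Require Import all_boot all_order all_algebra.
From mathcomp Require Import finmap monalg.
From mathcomp Require Import classical_sets reals complex.
From mathcomp Require Import boolp zify ring.

Set Implicit Arguments.
Unset Strict Implicit.
Unset Printing Implicit Defensive.

Import Order.TTheory GRing.Theory Num.Theory.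

Local Open Scope ring_scope.
Local Open Scope complex_scope.

(** * Spans, freeness and dimension for families given by lists *)

Section Span.
Context {F : fieldType} {V : lmodType F}.
Implicit Types (A S : set V) (s t : seq V).

Lemma submod0 A : submod_closed (mem A) -> A 0.
Proof. by case=> /set_mem. Qed.

Lemma submodP A : submod_closed (mem A) ->
  forall c x y, A x -> A y -> A (c *: x + y).
Proof. by case=> _ lA c x y /mem_set Ax /mem_set Ay; exact/set_mem/lA. Qed.

Lemma submodZ {A c x} : submod_closed (mem A) -> A x -> A (c *: x).
Proof.
by move=> lA Ax; rewrite -[_ *: _]addr0; exact: (submodP lA c Ax (submod0 lA)).
Qed.

Lemma submodD {A x y} : submod_closed (mem A) -> A x -> A y -> A (x + y).
Proof. by move=> lA Ax Ay; rewrite -[x]scale1r; exact: submodP. Qed.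

Lemma submodZV {A c x} : submod_closed (mem A) -> c != 0 -> A (c *: x) -> A x.
Proof. by move=> lA c0 /(submodZ (c := c^-1) lA); rewrite scalerA mulVf ?scale1r. Qed.

Lemma lspan_nil x : lspan ([::] : seq V) x <-> x = 0.
Proof.
split=> [[c ->]|->]; first by rewrite big_ord0.
by exists (fun=> 0); rewrite big_ord0.
Qed.

Lemma lspan_cons x s y : lspan (x :: s) y <-> exists c, lspan s (y - c *: x).
Proof.
split=> [[c ->]|[c [d e]]].
  exists (c ord0), (fun i => c (lift ord0 i)).
  by rewrite big_ord_recl /= addrAC subrr add0r.
exists (fun i => if unlift ord0 i is Some j then d j else c).
rewrite big_ord_recl /= unlift_none; under eq_bigr do rewrite liftK.
by rewrite -e addrC subrK.
Qed.

Lemma lspan_submod s : submod_closed (mem (lspan s)).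
Proof.
split.
  apply/mem_set; exists (fun=> 0); rewrite big1 // => i _; exact: scale0r.
move=> a x y /set_mem[c ->] /set_mem[d ->]; apply/mem_set.
exists (fun i => a * c i + d i); rewrite scaler_sumr -big_split /=.
by apply: eq_bigr => i _; rewrite scalerDl scalerA.
Qed.

Lemma sub_lspan A s : submod_closed (mem A) ->
  (forall x, x \in s -> A x) -> forall y, lspan s y -> A y.
Proof.
move=> lA; elim: s => [|x s IH] sA y; first by move/lspan_nil->; exact: submod0.
move=> /lspan_cons[c] /IH h; rewrite -[y](subrK (c *: x)); apply: submodD => //.
  by apply: h => z zs; apply: sA; rewrite inE zs orbT.
by apply: submodZ => //; apply: sA; rewrite inE eqxx.
Qed.

Lemma mem_lspan s x : x \in s -> lspan s x.
Proof.
elim: s => // y s IH; rewrite inE => /orP[/eqP->|/IH h]; apply/lspan_cons.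
  by exists 1; rewrite scale1r subrr; exact: (submod0 (lspan_submod s)).
by exists 0; rewrite scale0r subr0.
Qed.

Lemma lspan_eq A s : submod_closed (mem A) -> (forall x, x \in s -> A x) ->
  (forall x, A x -> lspan s x) -> A = lspan s.
Proof. by move=> lA sA As; apply/seteqP; split=> //; exact: sub_lspan. Qed.

Lemma lfree_nil : lfree ([::] : seq V).
Proof. by move=> c _ []. Qed.

Lemma lfree_cons x s : lfree s ->
  (forall c, lspan s (c *: x) -> c = 0) -> lfree (x :: s).
Proof.
move=> fs xs c; rewrite big_ord_recl /= => e.
have c0 : c ord0 = 0.
  apply: xs; exists (fun i => - c (lift ord0 i)).
  under eq_bigr do rewrite scaleNr.
  by rewrite sumrN; apply/eqP; rewrite -addr_eq0; exact/eqP.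
move: e; rewrite c0 scale0r add0r => /(fs (fun i => c (lift ord0 i))) h i.
by case: (unliftP ord0 i) => [j ->|->].
Qed.

(** A matrix of coordinates of [s] in terms of [t] has independent rows, so its number of rows is
    its rank, which its number of columns bounds. *)
Lemma lfree_leq_size s t : lfree s -> (forall x, x \in s -> lspan t x) ->
  (size s <= size t)%N.
Proof.
move=> fs st.
have /fin_all_exists[f fE] (i : 'I_(size s)) :
    exists c : 'I_(size t) -> F, s`_i = \sum_(j < size t) c j *: t`_j.
  by apply: st; exact: mem_nth.
pose M := \matrix_(i, j) f i j.
suff /eqP <- : row_free M by exact: rank_leq_col.
apply: inj_row_free => v vM; apply/rowP => i; rewrite mxE.
apply: (fs (fun i => v 0 i)).
under eq_bigr => j _ do rewrite fE scaler_sumr.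
rewrite exchange_big big1 //= => j _.
under eq_bigr => k _ do rewrite scalerA.
rewrite -scaler_suml; have /rowP/(_ j) := vM; rewrite !mxE => e.
rewrite -[RHS](scale0r t`_j) -[in RHS]e; congr (_ *: _).
by apply: eq_bigr => k _; rewrite !mxE.
Qed.

Lemma has_dim_uniq A d s : has_dim A d -> lfree s -> A = lspan s -> d = size s.
Proof.
move=> [t [<- ft At]] fs As; apply/eqP; rewrite eqn_leq.
by rewrite !lfree_leq_size // => x xs; [rewrite -At As|rewrite -As At];
   exact: mem_lspan.
Qed.

End Span.

(** * Highest and lowest exponents of Laurent polynomials and of their brackets *)

Section Extremes.
Context {C : numFieldType}.
Implicit Types (f g : laurent C) (B S : set (laurent C)) (m n : int) (e : bool).

Lemma mcoeff_lmul f g m : (f * g)@_m = \sum_(i <- msupp f) f@_i * g@_(m - i).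
Proof.
rewrite [f * g](_ : _ = lmul f g) // lmulE raddf_sum; apply: eq_bigr => i _.
rewrite raddf_sum /=; have [gi|gi] := boolP (m - i \in msupp g).
  rewrite (big_fsetD1 (m - i)) //= mcoeffU big_seq big1 ?addr0.
    have -> : i + (m - i) = m by lia.
    by rewrite eqxx.
  move=> j; rewrite !inE mcoeffU => /andP[/eqP ji _].
  by case: eqP => // ij; case: ji; rewrite -ij addrC addKr.
rewrite (mcoeff_outdom gi) mulr0 big_seq big1 // => j gj.
rewrite mcoeffU; case: eqP => // ij; case/negP: gi.
by rewrite -ij addrC addKr.
Qed.

(** The bracket of t^i and t^j is (j - i) t^(i+j), and j = m - i turns the factor into m - 2i. *)
Lemma mcoeff_witt_bracket f g m : (witt_bracket f g)@_m
  = \sum_(i <- msupp f) f@_i * g@_(m - i) * (m - i *+ 2)%:~R.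
Proof.
rewrite /witt_bracket mcoeffB mcoeff_lmul mulrC.
have -> : (lder f * g)@_m = \sum_(i <- msupp f) (lder f)@_i * g@_(m - i).
  rewrite mcoeff_lmul; apply: big_fset_incl => [|i _ /mcoeff_outdom->].
    apply/fsubsetP => i; rewrite -!mcoeff_neq0 mcoeff_lder.
    by apply: contra => /eqP->; rewrite mul0r.
  by rewrite mul0r.
rewrite -sumrB; apply: eq_bigr => i _; rewrite !mcoeff_lder.
by rewrite mulr2n opprD addrA [(m - i - i)%:~R]rmorphB /=; ring.
Qed.

Lemma witt_bracketxx f : witt_bracket f f = 0.
Proof. exact: subrr. Qed.

Lemma witt_bracketDr f g h :
  witt_bracket f (g + h) = witt_bracket f g + witt_bracket f h.
Proof. by rewrite /witt_bracket raddfD /= mulrDr mulrDl opprD addrACA. Qed.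

Lemma witt_bracketZr c f g : witt_bracket f (c *: g) = c *: witt_bracket f g.
Proof. by rewrite /witt_bracket linearZ /= -scalerAr -scalerAl scalerBr. Qed.

Lemma mcoeff_lmon m n : (lmon m : laurent C)@_n = (m == n)%:R.
Proof. by rewrite mcoeffU; case: eqP. Qed.

(* [ext true f m] says that m is the highest exponent of f, and [ext false f m]
   that m is the lowest one. *)
Definition beyond e m n : bool := if e then m < n else n < m.
Definition ext e f m : Prop := f@_m != 0 /\ forall n, beyond e m n -> f@_n = 0.

Lemma ext_exists e f : f != 0 -> exists m, ext e f m.
Proof.
move=> f0; have [m fm mP] : exists2 m, m \in (msupp f : seq int) &
    forall n, n \in (msupp f : seq int) -> ~~ beyond e m n.
  have : (msupp f : seq int) != [::].
    apply: contraNneq f0 => h; rewrite (laurentE f) big_seq big1 // => i.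
    by rewrite h.
  elim: (msupp f : seq int) => // a [|b s] IH _.
    exists a => [|n]; rewrite ?mem_seq1 ?eqxx // => /eqP->.
    by rewrite /beyond; case: e {IH}; rewrite ltxx.
  have [//|m ms mP] := IH; have [am|am] := boolP (beyond e m a).
    exists a; rewrite ?inE ?eqxx // => n; rewrite inE => /orP[/eqP->|/mP].
      by rewrite /beyond; case: e {IH mP am}; rewrite ltxx.
    by move: am; rewrite /beyond; case: e {IH mP}; lia.
  exists m; first by rewrite inE ms orbT.
  by move=> n; rewrite inE => /orP[/eqP->|/mP].
exists m; split; first by rewrite mcoeff_neq0.
by move=> n mn; apply: mcoeff_outdom; apply: contraL mn; exact: mP.
Qed.

Lemma ext_le f m n : ext true f m -> f@_n != 0 -> n <= m.
Proof. by move=> [_ h]; case: ltP => // /h->; rewrite eqxx. Qed.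

Lemma ext_ge f m n : ext false f m -> f@_n != 0 -> m <= n.
Proof. by move=> [_ h]; case: ltP => // /h->; rewrite eqxx. Qed.

Lemma ext_lmon f m : ext true f m -> ext false f m -> f = f@_m *: lmon m.
Proof.
move=> [_ f1] [_ f2]; apply/malgP => n; rewrite mcoeffZ mcoeff_lmon.
by case: ltgtP => [/f1->|/f2->|->]; rewrite ?mulr0 ?mulr1.
Qed.

Lemma ext_lmonP e m : ext e (lmon m) m.
Proof.
split=> [|n]; rewrite mcoeff_lmon ?eqxx ?oner_eq0 // /beyond.
by case: e; case: ltgtP.
Qed.

(** For i other than m, either i lies beyond m or m + n - i lies beyond n, so only the two extreme
    terms contribute in degree m + n. *)
Lemma ext_witt_bracket_coeff e f g m n : ext e f m -> ext e g n ->
  (witt_bracket f g)@_(m + n) = f@_m * g@_n * (n - m)%:~R.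
Proof.
move=> [fm fP] [gn gP]; rewrite mcoeff_witt_bracket.
rewrite (big_fsetD1 m) -?mcoeff_neq0 //= big_seq big1 ?addr0.
  have -> : m + n - m = n by lia.
  by have -> : m + n - m *+ 2 = n - m by lia.
move=> i; rewrite !inE => /andP[im _].
have [h|h] := boolP (beyond e m i); first by rewrite fP // !mul0r.
rewrite [g@_ _]gP ?mulr0 ?mul0r //.
by move: h im; rewrite /beyond; case: e {fP gP}; lia.
Qed.

Lemma ext_witt_bracket e f g m n : ext e f m -> ext e g n -> m != n ->
  ext e (witt_bracket f g) (m + n).
Proof.
move=> fe ge mn; split.
  rewrite (ext_witt_bracket_coeff fe ge) !mulf_neq0 ?fe.1 ?ge.1 //.
  by rewrite intr_eq0 subr_eq0 eq_sym.
move=> k; case: fe ge => [fm fP] [gn gP] mk.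
rewrite mcoeff_witt_bracket big1 // => i _.
have [h|h] := boolP (beyond e m i); first by rewrite fP // !mul0r.
rewrite [g@_ _]gP ?mulr0 ?mul0r //.
by move: h mk; rewrite /beyond; case: e {fP gP}; lia.
Qed.

Lemma ext0 e m : ~ ext e 0 m.
Proof. by case=> /negP[]; rewrite mcoeff0. Qed.

Lemma ext_neq0 e f m : ext e f m -> f != 0.
Proof. by move=> h; apply: contra_notN (@ext0 e m) => /eqP <-. Qed.

Lemma ext_Z e c f m : c != 0 -> ext e f m -> ext e (c *: f) m.
Proof.
move=> c0 [fm fP]; split; first by rewrite mcoeffZ mulf_neq0.
by move=> n /fP h; rewrite mcoeffZ h mulr0.
Qed.

(** The only consequence of finite dimension on which the classification in the Witt algebra
    relies. *)
Definition bounded B := exists N : nat,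
  forall f, B f -> forall m, f@_m != 0 -> (absz m <= N)%N.

Lemma lspan_bounded (s : seq (laurent C)) : bounded (lspan s).
Proof.
elim: s => [|x s [N NP]].
  by exists 0%N => f /lspan_nil-> m; rewrite mcoeff0 eqxx.
have [M MP] : exists M : nat, forall m, x@_m != 0 -> (absz m <= M)%N.
  have [->|x0] := eqVneq x 0; first by exists 0%N => m; rewrite mcoeff0 eqxx.
  have [a aP] := ext_exists true x0; have [b bP] := ext_exists false x0.
  exists (absz a + absz b)%N => m mx.
  by move: (ext_le aP mx) (ext_ge bP mx); lia.
exists (maxn M N) => f /lspan_cons[c /NP h] m fm.
have := h m; rewrite leq_max mcoeffB mcoeffZ.
have [->|/MP-> //] := eqVneq x@_m 0.
by rewrite mulr0 subr0 => ->; rewrite ?orbT.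
Qed.

(* Leading terms can be cancelled successively, so a subspace of B meeting
   every extreme exponent of B is all of B. *)
Lemma sub_of_ext e B S : submod_closed (mem B) -> submod_closed (mem S) ->
  bounded B ->
  (forall m f, B f -> ext e f m -> exists x, [/\ B x, S x & ext e x m]) ->
  forall f, B f -> S f.
Proof.
move=> lB lS [N NP] BS f Bf.
(* Induction on a window of [j] exponents, counted upwards from [- N] if [e] is true and downwards
   from [N] otherwise; a window of [N.*2.+1] exponents covers everything. *)
suff H (j : nat) : forall f, B f -> (forall m, f@_m != 0 ->
    beyond e m (if e then j%:Z - N%:Z else N%:Z - j%:Z)) -> S f.
  apply: (H (N.*2.+1)) => // m /(NP _ Bf).
  by rewrite /beyond; case: (e); lia.
elim: j {f Bf} => [|j IH] f Bf fP;
    (have [->|f0] := eqVneq f 0; first exact: (submod0 lS));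
    have [m fm] := ext_exists e f0.
  have := NP _ Bf m fm.1; have := fP m fm.1.
  by rewrite /beyond; case: (e); lia.
have [x [Bx Sx xm]] := BS m f Bf fm.
rewrite -[f](subrK ((f@_m / x@_m) *: x)); apply: submodD => //; last first.
  exact: submodZ.
apply: IH => [|k].
  by rewrite -scaleNr; apply: submodD => //; exact: submodZ.
rewrite mcoeffB mcoeffZ => hk.
have := fP m fm.1; case: (eqVneq k m) hk => [->|km].
  by rewrite divfK ?xm.1 // subrr eqxx.
have [h|h] := boolP (beyond e m k).
  by rewrite (xm.2 _ h) (fm.2 _ h) mulr0 subrr eqxx.
by move: h km; rewrite /beyond; case: (e); lia.
Qed.

(** The coefficient at m is a linear form that vanishes on the span of [s] but not at [x]. *)
Lemma lfree_cons_ext (x : laurent C) s m : lfree s -> x@_m != 0 ->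
  (forall y, y \in s -> y@_m = 0) -> lfree (x :: s).
Proof.
move=> fs xm ym; apply: lfree_cons => // c h.
have lS : submod_closed (mem [set y : laurent C | y@_m = 0]%classic).
  split=> [|a y z /set_mem/= hy /set_mem/= hz]; apply/mem_set => /=.
    exact: mcoeff0.
  by rewrite mcoeffD mcoeffZ hy hz mulr0 addr0.
have /= := sub_lspan lS ym h; rewrite mcoeffZ => /eqP.
by rewrite mulf_eq0 (negPf xm) orbF => /eqP.
Qed.

End Extremes.

(** * Extreme exponents of a bounded Witt subalgebra *)

Section WittSubalgebras.
Context {C : numFieldType}.
Implicit Types (f g x y : laurent C) (B : set (laurent C)) (m n k : int).

Definition witt_subalgebra B : Prop :=
  submod_closed (mem B) /\ forall f g, B f -> B g -> B (witt_bracket f g).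

Definition exts e B m : Prop := exists2 f, B f & ext e f m.

Section Exts.
Variables (B : set (laurent C)) (e : bool).
Hypotheses (lieB : witt_subalgebra B) (bB : bounded B).

Lemma exts_add m n : exts e B m -> exts e B n -> m != n -> exts e B (m + n).
Proof.
move=> [f Bf fm] [g Bg gn] mn; exists (witt_bracket f g).
  exact: lieB.2.
exact: ext_witt_bracket.
Qed.

(** Of two distinct nonzero exponents with the same sign, the one smaller in absolute value could be
    added to the other again and again, against boundedness. *)
Lemma exts_same_sign m n : exts e B m -> exts e B n ->
  (0 < m) = (0 < n) -> m != 0 -> n != 0 -> m = n.
Proof.
have H a b : exts e B a -> exts e B b -> (0 < a) = (0 < b) -> a != 0 ->
    (absz a < absz b)%N -> False.
  move=> Ea Eb sab a0 ab; case: bB => N NP.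
  (* The exponents b, b + a, b + 2a, ... exceed [a] in absolute value, hence differ from it, so
     [exts_add] applies at each of the N + 1 steps. *)
  have [k [[f Bf fk] k1 k2]] : exists k, [/\ exts e B k,
      0 < a -> b + N.+1%:Z <= k & a <= 0 -> k <= b - N.+1%:Z].
    elim: N.+1 => [|j [k [Ek k1 k2]]]; first by exists b; split=> //; lia.
    exists (a + k); split; try lia.
    by apply: exts_add => //; lia.
  by have := NP _ Bf _ fk.1; lia.
move=> Em En smn m0 n0; have [h|h|h] := ltngtP (absz m) (absz n); last by lia.
  by case: (H m n).
by case: (H n m).
Qed.

(** If the signs differ and m + n is nonzero, then m + n is an extreme exponent with the sign of [m]
    or of [n], hence equal to that one, which forces the other to be 0. *)
Lemma exts_nz m n : exts e B m -> exts e B n -> m != 0 -> n != 0 ->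
  n = m \/ n = - m.
Proof.
move=> Em En m0 n0; have [|/negP smn] := boolP ((0 < m) == (0 < n)).
  by move/eqP => h; left; exact: exts_same_sign.
have mn : m != n by apply/negP => /eqP mn; apply: smn; rewrite mn.
have [h|h] := eqVneq (m + n) 0; first by right; lia.
have Es := exts_add Em En mn.
have [s|s] := boolP ((0 < m) == (0 < m + n)).
  by have := exts_same_sign Em Es (eqP s) m0 h; lia.
by have := exts_same_sign En Es; lia.
Qed.

Lemma eq_lspan_ext (s : seq (laurent C)) : (forall x, x \in s -> B x) ->
  (forall m, exts e B m -> exists2 x, x \in s & ext e x m) -> B = lspan s.
Proof.
move=> sB h; apply: (lspan_eq lieB.1) => //.
apply: (sub_of_ext (e := e) lieB.1 (lspan_submod s) bB) => m f Bf fm.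
have [|x xs xm] := h m; first by exists f.
by exists x; split=> //; [exact: sB|exact: mem_lspan].
Qed.

(** The dimension is recorded because it does not depend on [e]: it later matches the case of the
    highest exponents with that of the lowest ones. *)
Lemma exts_cases :
  [\/ B = lspan [::],
      exists2 f, f != 0 & B = lspan [:: f],
      exists m, [/\ m != 0, forall k, exts e B k <-> k = 0 \/ k = m
                  & has_dim B 2]
    | exists m, [/\ 0 < m, forall k, exts e B k <-> [\/ k = 0, k = m | k = - m]
                  & has_dim B 3]].
Proof.
have [[m [m0 Em]]|noE] := pselect (exists m, m != 0 /\ exts e B m); last first.
  have [[f Bf f0]|no0] := pselect (exts e B 0).
    apply: Or42; exists f; first exact: ext_neq0 f0.
    apply: eq_lspan_ext => [x|m Em]; first by rewrite inE => /eqP->.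
    exists f; rewrite ?inE //; have [->//|m0] := eqVneq m 0.
    by case: noE; exists m.
  apply: Or41; apply: eq_lspan_ext => // m Em; have [m0|m0] := eqVneq m 0.
    by case: no0; rewrite -m0.
  by case: noE; exists m.
have [Em'|Em'] := pselect (exts e B (- m)).
  wlog m_gt0 : m m0 Em Em' / 0 < m => [H|].
    have [|h] := ltP 0 m; first exact: H.
    by apply: (H (- m)); rewrite ?opprK ?oppr_eq0 //; lia.
  have E0 : exts e B 0.
    by rewrite -(subrr m); apply: exts_add => //; lia.
  have [[f Bf fm] [g Bg gm] [h Bh h0]] := And3 Em Em' E0.
  have EE k : exts e B k <-> [\/ k = 0, k = m | k = - m].
    split=> [Ek|[]-> //]; have [->|k0] := eqVneq k 0; first exact: Or31.
    by case: (exts_nz Em Ek m0 k0) => ->; [exact: Or32|exact: Or33].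
  apply: Or44; exists m; split=> //.
  (* The list starts from the farthest exponent in the direction [e], so each coefficient that
     serves to prove freeness vanishes on all later members. *)
  pose s := if e then [:: f; h; g] else [:: g; h; f].
  exists s; split; first by rewrite /s; case: (e).
    rewrite /s; move: fm gm h0; rewrite /ext /beyond.
    case: (e) => -[fm fP] [gm gP] [h0 hP].
      apply: (lfree_cons_ext (m := m)) fm _ => [|y].
        apply: (lfree_cons_ext (m := 0)) h0 _ => [|y].
          by apply: (lfree_cons_ext (m := - m)) gm _ => //; exact: lfree_nil.
        by rewrite !inE => /eqP->; apply: gP; lia.
      by rewrite !inE => /orP[]/eqP->; [apply: hP|apply: gP; lia].
    apply: (lfree_cons_ext (m := - m)) gm _ => [|y].
      apply: (lfree_cons_ext (m := 0)) h0 _ => [|y].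
        by apply: (lfree_cons_ext (m := m)) fm _ => //; exact: lfree_nil.
      by rewrite !inE => /eqP->; apply: fP; lia.
    by rewrite !inE => /orP[]/eqP->; [apply: hP|apply: fP]; lia.
  apply: eq_lspan_ext => [x|k /EE[]->].
  - by rewrite /s; case: (e); rewrite !inE => /or3P[]/eqP->.
  - by exists h; rewrite // /s; case: (e); rewrite !inE eqxx ?orbT.
  - by exists f; rewrite // /s; case: (e); rewrite !inE eqxx ?orbT.
  - by exists g; rewrite // /s; case: (e); rewrite !inE eqxx ?orbT.
have Enz k : exts e B k -> k != 0 -> k = m.
  by move=> Ek k0; case: (exts_nz Em Ek m0 k0) => // h; case: Em'; rewrite -h.
have [f Bf fm] := Em; have [E0|no0] := pselect (exts e B 0); last first.
  apply: Or42; exists f; first exact: ext_neq0 fm.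
  apply: eq_lspan_ext => [x|k Ek]; first by rewrite inE => /eqP->.
  exists f; rewrite ?inE // (Enz k) //; apply/eqP => k0.
  by apply: no0; rewrite -k0.
have [h Bh h0] := E0.
have EE k : exts e B k <-> k = 0 \/ k = m.
  split=> [Ek|[]-> //]; have [->|k0] := eqVneq k 0; first by left.
  by right; exact: Enz.
apply: Or43; exists m; split=> //.
pose s := if beyond e 0 m then [:: f; h] else [:: h; f].
exists s; split; first by rewrite /s; case: ifP.
  rewrite /s; case: ifP => em.
    apply: (lfree_cons_ext (m := m)) fm.1 _ => [|y].
      by apply: (lfree_cons_ext (m := 0)) h0.1 _ => //; exact: lfree_nil.
    by rewrite !inE => /eqP->; exact: h0.2.
  apply: (lfree_cons_ext (m := 0)) h0.1 _ => [|y].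
    by apply: (lfree_cons_ext (m := m)) fm.1 _ => //; exact: lfree_nil.
  rewrite !inE => /eqP->; apply: fm.2; move: em m0; rewrite /beyond.
  by case: (e); lia.
apply: eq_lspan_ext => [x|k /EE[]->].
- by rewrite /s; case: ifP; rewrite !inE => _ /orP[]/eqP->.
- by exists h; rewrite // /s; case: ifP; rewrite !inE eqxx ?orbT.
- by exists f; rewrite // /s; case: ifP; rewrite !inE eqxx ?orbT.
Qed.

End Exts.
End WittSubalgebras.

Lemma mem_snd (T : eqType) (x y : T) s : y \in [:: x, y & s].
Proof. by rewrite !inE eqxx orbT. Qed.

Lemma mem_trd (T : eqType) (x y z : T) s : z \in [:: x, y, z & s].
Proof. by rewrite !inE eqxx !orbT. Qed.

(** * Classification of bounded Witt subalgebras *)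

Section WittClassification.
Context {C : numFieldType}.
Implicit Types (B : set (laurent C)) (m : int) (n w : nat).

(* The normal form of a nonabelian pair that is not spanned by monomials: P is
   a monic polynomial of degree n with P(0) != 0, and Q has the shape
   t^{-w} (t^{n+w} + ... + c) with c != 0, normalised so that P and Q have the
   same leading term and the positive powers of t cancel in P - Q. *)
Record witt_pair n w (l : C) (P Q : laurent C) : Prop := WittPair {
  wp_n : (0 < n)%N;
  wp_w : (0 < w)%N;
  wp_l : l != 0;
  wp_Plo : ext false P 0;
  wp_Phi : ext true P n;
  wp_P1 : P@_n%:Z = 1;
  wp_Qlo : ext false Q (- w%:Z);
  wp_Qhi : ext true Q n;
  wp_Q1 : Q@_n%:Z = 1;
  wp_PQ : ext true (P - Q) 0;
  wp_br : witt_bracket P Q = l *: Q }.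

Lemma mem_lmon B f m : submod_closed (mem B) -> B f -> ext true f m ->
  ext false f m -> B (lmon m).
Proof.
move=> lB Bf f1 f2; apply: (submodZV (c := f@_m)) => //; first exact: f1.1.
by rewrite -ext_lmon.
Qed.

Lemma witt_bracket_lmon0 (f : laurent C) m :
  (witt_bracket (lmon 0) f)@_m = f@_m * m%:~R.
Proof.
by rewrite /witt_bracket lder_lmon mulr0z lterm0 mulr0 subr0 mul1r mcoeff_lder.
Qed.

Lemma lspan2P (x y z : laurent C) :
  lspan [:: x; y] z -> exists a b, z = a *: x + b *: y.
Proof.
move=> /lspan_cons[a /lspan_cons[b /lspan_nil /eqP]].
by rewrite subr_eq0 subr_eq addrC => /eqP->; exists a, b.
Qed.

Section Classification.
Variable B : set (laurent C).
Hypotheses (lieB : witt_subalgebra B) (bB : bounded B).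
Let lB := lieB.1.

(** Bracketing with [lmon 0] multiplies the coefficient at k by k. If the bracket with X is a + b X,
    then (k - b) X_k = 0 for nonzero k, and k = m gives b = m. So X lives in degrees 0 and m, and
    removing its constant term leaves a monomial. *)
Lemma dim2_monomial m : m != 0 ->
  (forall k, exts true B k <-> k = 0 \/ k = m) -> B (lmon 0) ->
  B = lspan [:: lmon 0; lmon m].
Proof.
move=> m0 T B1; have [X BX Xm] : exts true B m by apply/T; right.
have BX1 : B = lspan [:: lmon 0; X].
  apply: (@eq_lspan_ext _ B true lieB bB) => [x|k /T[]->].
  - by rewrite !inE => /orP[]/eqP->.
  - by exists (lmon 0); [exact: mem_head|exact: ext_lmonP].
  - by exists X; first exact: mem_snd.
have : B (witt_bracket (lmon 0) X) by exact: lieB.2.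
rewrite {1}BX1 => /lspan2P[a [b E]].
have Ek k : X@_k * k%:~R = a * (0 == k)%:R + b * X@_k.
  by rewrite -witt_bracket_lmon0 E mcoeffD !mcoeffZ mcoeff_lmon.
have bE : b = m%:~R.
  apply: (mulIf Xm.1); rewrite [RHS]mulrC Ek eq_sym (negPf m0) mulr0.
  by rewrite add0r.
have Bm : B (lmon m).
  apply: (submodZV (c := X@_m)) => //; first exact: Xm.1.
  suff -> : X@_m *: lmon m = - X@_0 *: lmon 0 + X by exact: submodP.
  apply/malgP => k; rewrite mcoeffD !mcoeffZ !mcoeff_lmon.
  have [<-|mk] := eqVneq m k.
    by rewrite eq_sym (negPf m0) mulr0 add0r mulr1.
  have [<-|k0] := eqVneq 0 k; first by rewrite mulr0 mulr1 addNr.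
  rewrite !mulr0 add0r; apply/esym/eqP.
  have : X@_k * (k - m)%:~R == 0.
    rewrite rmorphB /= mulrBr Ek (negPf k0) mulr0 add0r bE mulrC.
    by rewrite subrr.
  by rewrite mulf_eq0 intr_eq0 subr_eq0 [k == m]eq_sym (negPf mk) orbF.
apply: (@eq_lspan_ext _ B true lieB bB) => [x|k /T[]->].
- by rewrite !inE => /orP[]/eqP->.
- by exists (lmon 0); [exact: mem_head|exact: ext_lmonP].
- by exists (lmon m); [exact: mem_snd|exact: ext_lmonP].
Qed.

(** Some P in B has lowest exponent 0 and some R has highest exponent 0. If [P, R] = a P + b R with
    a and b nonzero, then Q = P + (b / a) R satisfies [P, Q] = b Q. *)
Lemma dim2_pair n w : (0 < n)%N -> (0 < w)%N ->
  (forall k, exts true B k <-> k = 0 \/ k = n) ->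
  (forall k, exts false B k <-> k = 0 \/ k = - w%:Z) ->
  ~ B (lmon 0) ->
  exists l P Q, witt_pair n w l P Q /\ B = lspan [:: P; Q].
Proof.
move=> n0 w0 T S no1.
have [P [BP Plo Phi P1]] : exists P, [/\ B P, ext false P 0, ext true P n
    & P@_n%:Z = 1].
  have [P BP Plo] : exts false B 0 by apply/S; left.
  have [k Pk] := ext_exists true (ext_neq0 Plo).
  have /T : exts true B k by exists P.
  (* With highest and lowest exponent both 0, [P] would be a multiple of [lmon 0], which is
     excluded. *)
  case=> kE; subst k; first by case: no1; exact: mem_lmon BP _ _.
  have c0 : (P@_n%:Z)^-1 != 0 by rewrite invr_eq0 Pk.1.
  exists ((P@_n%:Z)^-1 *: P); split; try exact: ext_Z; first exact: submodZ.
  by rewrite mcoeffZ mulVf // Pk.1.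
have [R [BR Rhi Rlo]] : exists R, [/\ B R, ext true R 0 & ext false R (- w%:Z)].
  have [R BR Rhi] : exts true B 0 by apply/T; left.
  have [k Rk] := ext_exists false (ext_neq0 Rhi).
  have /S : exts false B k by exists R.
  case=> kE; subst k; first by case: no1; exact: mem_lmon BR _ _.
  by exists R.
have BPR : B = lspan [:: P; R].
  apply: (@eq_lspan_ext _ B true lieB bB) => [x|k /T[]->].
  - by rewrite !inE => /orP[]/eqP->.
  - by exists R; first exact: mem_snd.
  - by exists P; first exact: mem_head.
have : B (witt_bracket P R) by exact: lieB.2.
rewrite {1}BPR => /lspan2P[a [b E]].
have Pw : P@_(- w%:Z) = 0 by apply: Plo.2; rewrite /beyond; lia.
have Rn : R@_n%:Z = 0 by apply: Rhi.2; rewrite /beyond; lia.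
(* The bracket has a nonzero term in degree n, where [R] has none; for [b0] the same is done in
   degree -w, where [P] has none. *)
have a0 : a != 0.
  have [] := ext_witt_bracket Phi Rhi; first by lia.
  rewrite addr0 E mcoeffD !mcoeffZ Rn mulr0 addr0 => h _.
  by apply: contraNneq h => ->; rewrite mul0r.
have b0 : b != 0.
  have [] := ext_witt_bracket Plo Rlo; first by lia.
  rewrite add0r E mcoeffD !mcoeffZ Pw mulr0 add0r => h _.
  by apply: contraNneq h => ->; rewrite mul0r.
have d0 : b / a != 0 by rewrite mulf_neq0 ?invr_eq0.
pose Q := P + (b / a) *: R.
have Q1 : Q@_n%:Z = 1 by rewrite mcoeffD mcoeffZ Rn mulr0 addr0.
have Qlo : ext false Q (- w%:Z).
  split; first by rewrite mcoeffD mcoeffZ Pw add0r mulf_neq0 ?Rlo.1.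
  move=> k kw; rewrite mcoeffD mcoeffZ (Rlo.2 _ kw) mulr0 addr0.
  by apply: Plo.2; move: kw; rewrite /beyond; lia.
exists b, P, Q; split.
  split=> //.
  - split; first by rewrite Q1 oner_eq0.
    move=> k kw; rewrite mcoeffD mcoeffZ (Phi.2 _ kw) add0r.
    by rewrite [R@_k]Rhi.2 ?mulr0 //; move: kw; rewrite /beyond; lia.
  - by rewrite /Q opprD addrA subrr add0r -scaleNr; apply: ext_Z; rewrite ?oppr_eq0.
  - rewrite witt_bracketDr witt_bracketxx add0r witt_bracketZr E /Q !scalerDr.
    by rewrite !scalerA divfK // mulrC mulrA.
apply: (@eq_lspan_ext _ B false lieB bB) => [x|k /S[]->].
- rewrite !inE => /orP[]/eqP-> //; apply: submodD => //; exact: submodZ.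
- by exists P; first exact: mem_head.
- by exists Q; first exact: mem_snd.
Qed.

(** A member with lowest exponent m' has a positive highest exponent, which must be m, so m' <= m; a
    member with highest exponent -m has lowest exponent -m', so m <= m'. Equality makes both of them
    monomials, and their bracket is a nonzero constant. *)
Lemma dim3_monomial m m' : 0 < m -> 0 < m' ->
  (forall k, exts true B k <-> [\/ k = 0, k = m | k = - m]) ->
  (forall k, exts false B k <-> [\/ k = 0, k = m' | k = - m']) ->
  B = lspan [:: lmon 0; lmon (- m); lmon m].
Proof.
move=> m0 m'0 T S.
have [Y BY Ylo] : exts false B m' by apply/S; exact: Or32.
have [k Yk] := ext_exists true (ext_neq0 Ylo).
have Tk : exts true B k by exists Y.
have := ext_le Yk Ylo.1; case/T: Tk => kE; try lia; subst k => m'm.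
have [X BX Xhi] : exts true B (- m) by apply/T; exact: Or33.
have [k Xk] := ext_exists false (ext_neq0 Xhi).
have Sk : exts false B k by exists X.
have := ext_ge Xk Xhi.1; case/S: Sk => kE; try lia; subst k => mm'.
have mE : m' = m by lia.
subst m'; have mNm : m != - m by lia.
have B0 : B (lmon 0).
  apply: (@mem_lmon B (witt_bracket Y X)) => //; first exact: lieB.2.
    by rewrite -(subrr m); exact: ext_witt_bracket.
  by rewrite -(subrr m); exact: ext_witt_bracket.
have Bm : B (lmon m) by exact: mem_lmon BY _ _.
have BNm : B (lmon (- m)) by exact: mem_lmon BX _ _.
apply: (@eq_lspan_ext _ B true lieB bB) => [x|k /T[]->].
- by rewrite !inE => /or3P[]/eqP->.
- by exists (lmon 0); [exact: mem_head|exact: ext_lmonP].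
- by exists (lmon m); [exact: mem_trd|exact: ext_lmonP].
- by exists (lmon (- m)); [exact: mem_snd|exact: ext_lmonP].
Qed.

(** Dimensions 2 and 3 exclude each other, so highest and lowest exponents fall into matching cases.
    In dimension 2 without [lmon 0], the signs of m and m' turn out as [dim2_pair] requires. *)
Lemma witt_classification :
  B = lspan [::]
  \/ (exists2 f, f != 0 & B = lspan [:: f])
  \/ (exists2 m, m != 0 & B = lspan [:: lmon 0; lmon m])
  \/ (exists n w l P Q, witt_pair n w l P Q /\ B = lspan [:: P; Q])
  \/ (exists2 m, 0 < m & B = lspan [:: lmon 0; lmon (- m); lmon m]).
Proof.
have dim23 : has_dim B 2 -> has_dim B 3 -> False.
  by move=> d2 [s [s3 fs Bs]]; have := has_dim_uniq d2 fs Bs; rewrite s3.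
case: (exts_cases true lieB bB) => [|[f f0 Bf]|[m [m0 T d]]|[m [m0 T d]]].
- by left.
- by right; left; exists f.
- case: (exts_cases false lieB bB) => [|[f f0 Bf]|[m' [m'0 S _]]|[_ [_ _ d']]].
  + by left.
  + by right; left; exists f.
  + do 2![right]; have [B1|no1] := pselect (B (lmon 0)).
      by left; exists m => //; exact: dim2_monomial.
    right; left.
    (* For negative m, a member with lowest exponent 0 would also have highest exponent 0. *)
    have m_gt0 : 0 < m.
      rewrite lt_def m0 leNgt; apply/negP => m_lt0; apply: no1.
      have [P BP Plo] : exts false B 0 by apply/S; left.
      have [k Pk] := ext_exists true (ext_neq0 Plo).
      have Tk : exts true B k by exists P.
      have := ext_le Pk Plo.1; case/T: Tk => kE; subst k; last by lia.
      by move=> _; exact: mem_lmon BP _ _.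
    have m'_lt0 : m' < 0.
      rewrite lt_def eq_sym m'0 leNgt; apply/negP => m'_gt0; apply: no1.
      have [R BR Rhi] : exts true B 0 by apply/T; left.
      have [k Rk] := ext_exists false (ext_neq0 Rhi).
      have Sk : exts false B k by exists R.
      have := ext_ge Rk Rhi.1; case/S: Sk => kE; subst k; last by lia.
      by move=> _; exact: mem_lmon BR _ _.
    exists (absz m), (absz m'); apply: dim2_pair => //; try lia.
      by have -> : (absz m)%:Z = m by lia.
    by have -> : - (absz m')%:Z = m' by lia.
  + by case: dim23.
- case: (exts_cases false lieB bB) => [|[f f0 Bf]|[_ [_ _ d']]|[m' [m'0 S _]]].
  + by left.
  + by right; left; exists f.
  + by case: dim23.
  + by do 4![right]; exists m => //; exact: dim3_monomial S.
Qed.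

End Classification.
End WittClassification.

(** * Multiplicities of roots in the polynomial form of the bracket equation *)

Section PolynomialPair.
Context {C : numClosedFieldType}.
Implicit Types (p q : {poly C}) (a b l : C) (s t : seq C).

Lemma sum_count_mem s t : uniq t -> {subset s <= t} ->
  (\sum_(a <- t) count_mem a s)%N = size s.
Proof.
move=> ut; elim: s => [|z s IH] st /=; first by rewrite big1.
rewrite big_split /= IH => [|x xs]; last by apply: st; rewrite inE xs orbT.
rewrite (bigD1_seq z) ?st ?mem_head //= eqxx big1 ?addn0 // => i.
by rewrite eq_sym => /negPf->.
Qed.

Lemma prod_count_mem s t : uniq t -> {subset s <= t} ->
  \prod_(a <- t) ('X - a%:P) ^+ count_mem a s
  = \prod_(a <- s) ('X - a%:P) :> {poly C}.
Proof.
move=> ut; elim: s => [|z s IH] st /=; first by rewrite big_nil big1.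
under eq_bigr do rewrite exprD.
rewrite big_split /= IH => [|x xs]; last by apply: st; rewrite inE xs orbT.
rewrite big_cons (bigD1_seq z) ?st ?mem_head //= eqxx big1 ?mulr1 // => i.
by rewrite eq_sym => /negPf->.
Qed.

(** Here [h] collects the factors with roots other than [a]. The derivative is multiplied by X - a
    so that no exponent e - 1 appears and multiplicity 0 is covered. *)
Lemma prod_XsubC_local a s (q := \prod_(z <- s) ('X - z%:P)) :
  exists h : {poly C}, [/\ h.[a] != 0, q = ('X - a%:P) ^+ count_mem a s * h
    & ('X - a%:P) * q^`() = ('X - a%:P) ^+ count_mem a s
                            * ((count_mem a s)%:R * h + ('X - a%:P) * h^`())].
Proof.
pose h : {poly C} := \prod_(z <- s | z != a) ('X - z%:P).
have qE : q = ('X - a%:P) ^+ count_mem a s * h.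
  rewrite /q /h; elim: s {q h} => [|z s IH]; first by rewrite !big_nil mulr1.
  rewrite !big_cons /= IH exprD.
  case: eqP => [->|_]; last by rewrite mul1r mulrCA.
  by rewrite expr1 mulrA.
exists h; split=> //.
  rewrite horner_prod prodf_seq_neq0; apply/allP => i _; apply/implyP => ij.
  by rewrite hornerXsubC subr_eq0 eq_sym.
rewrite qE derivM deriv_exp derivXsubC mul1r.
case: (count_mem a s) => [|e] /=; first by rewrite mulr0n expr0; ring.
by rewrite -mulr_natl exprS; ring.
Qed.

(* Lagrange interpolation of X^m at the nodes a_j, read off in degree n - 1. *)
Lemma sum_expr_div_deriv n (a : 'I_n -> C) (m : nat) : injective a ->
  (m.+1 < n)%N ->
  \sum_j a j ^+ m / (\prod_i ('X - (a i)%:P))^`().[a j] = 0.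
Proof.
move=> a_inj mn; set p := \prod_i _.
pose c j := \prod_(i | i != j) ('X - (a i)%:P).
have cE j : p^`().[a j] = (c j).[a j].
  rewrite /p (bigD1 j) //= derivM derivXsubC mul1r hornerD hornerM.
  by rewrite hornerXsubC subrr mul0r addr0.
have c0 j : (c j).[a j] != 0.
  rewrite horner_prod prodf_seq_neq0; apply/allP => i _; apply/implyP => ij.
  by rewrite hornerXsubC subr_eq0 (inj_eq a_inj) eq_sym.
have cj i j : i != j -> (c j).[a i] = 0.
  by move=> ij; rewrite horner_prod (bigD1 i) //= hornerXsubC subrr mul0r.
have size_c j : size (c j) = n.
  have : size p = n.+1 by rewrite size_prod_XsubC /index_enum -enumT size_enum_ord.
  rewrite /p (bigD1 j) //= -/(c j) size_monicM ?monicXsubC //; last first.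
    by apply: contraTneq (c0 j) => ->; rewrite horner0 eqxx.
  by rewrite size_XsubC addSn add1n /= => -[].
have lead_c j : (c j)`_n.-1 = 1.
  by rewrite -[in n.-1](size_c j) -lead_coefE lead_coef_prod_XsubC.
(* Since [c j] takes the value p'(a_j) at a_j and 0 at the other nodes, the sum of the [u j *: c j]
   interpolates X^m; [g] is then of degree below n with n zeros. *)
pose u j := a j ^+ m / p^`().[a j].
pose g := \sum_j u j *: c j - 'X^m.
suff g0 : g = 0.
  (* Each [c j] is monic of degree n - 1, while X^m has smaller degree. *)
  have := congr1 (fun f : {poly C} => f`_n.-1) g0.
  rewrite coefB coefXn coef_sum coef0 eq_sym ltn_eqF ?subr0; last by lia.
  by move=> e; rewrite -[RHS]e; apply: eq_bigr => j _; rewrite coefZ lead_c mulr1.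
pose rs := [seq a j | j <- enum 'I_n].
apply/eqP; apply/negPn/negP => g0.
have : (size rs < size g)%N.
  apply: max_poly_roots => //; last by rewrite map_inj_uniq ?enum_uniq.
  apply/allP => _ /mapP[j _ ->]; rewrite /root hornerD hornerN hornerXn.
  rewrite horner_sum (bigD1 j) //= big1 ?addr0 => [|i ij].
    by rewrite hornerZ /u cE divfK // subrr.
  by rewrite hornerZ cj ?mulr0 // eq_sym.
rewrite size_map size_enum_ord ltnNge => /negP; apply.
apply: leq_trans (size_polyD _ _) _; rewrite geq_max size_polyN size_polyXn.
rewrite (ltnW mn) andbT; apply: leq_trans (size_sum _ _ _) _.
apply/bigmax_leqP => j _; rewrite -[leqRHS](size_c j); exact: size_scale_leq.
Qed.

(* The residue of q'/q - p'/p at a simple root a of p, up to the factor p'(a). *)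
Lemma root_residue p q a l (w : nat) s :
  p * ('X * q^`() - w%:R * q) - q * ('X * p^`()) = l *: q ->
  q = \prod_(z <- s) ('X - z%:P) -> root p a ->
  ((count_mem a s)%:R - 1) * (a * p^`().[a]) = l.
Proof.
move=> E q_eq /factor_theorem[c pE].
have [h [h0]] := prod_XsubC_local a s; rewrite -q_eq.
move: (count_mem a s) => e qE qD.
have pD : p^`().[a] = c.[a].
  rewrite pE derivM derivXsubC mulr1 hornerD hornerM hornerXsubC subrr.
  by rewrite mulr0 add0r.
have X0 : ('X - a%:P) ^+ e != 0 :> {poly C} by rewrite expf_neq0 // polyXsubC_eq0.
(* This is [E] divided by (X - a)^e; at X = a it leaves (e - 1) a c(a) h(a) = l h(a). *)
have : c * 'X * (e%:R * h + ('X - a%:P) * h^`())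
    - c * ('X - a%:P) * w%:R * h - h * 'X * (c^`() * ('X - a%:P) + c) = l *: h.
  apply: (mulfI X0); rewrite -scalerAr -qE -E pE derivM derivXsubC mulr1.
  transitivity (c * 'X * (('X - a%:P) * q^`()) - c * ('X - a%:P) * w%:R * q
     - q * 'X * (c^`() * ('X - a%:P) + c)); last by ring.
  by rewrite qD qE; ring.
move/(congr1 (fun f : {poly C} => f.[a])).
rewrite -!polyC_natr.
rewrite !(hornerD, hornerN, hornerM, hornerZ, hornerX, hornerC).
rewrite subrr !(mul0r, mulr0, addr0, add0r, subr0).
by rewrite -pD => H; apply: (mulIf h0); rewrite -H; ring.
Qed.

(** If b has multiplicity e > 0 in q, all terms of the equation except p X q' are multiples of q,
    while q' vanishes at b only to order e - 1. As b is nonzero, p has to vanish there. *)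
Lemma root_of_pair p q b l (w : nat) s :
  p * ('X * q^`() - w%:R * q) - q * ('X * p^`()) = l *: q ->
  q = \prod_(z <- s) ('X - z%:P) -> b != 0 -> b \in s -> root p b.
Proof.
move=> E q_eq b0 bs; have [h [h0]] := prod_XsubC_local b s; rewrite -q_eq.
have : (0 < count_mem b s)%N by rewrite -has_count has_pred1.
move: (count_mem b s) => e e0 qE qD.
have X0 : ('X - b%:P) ^+ e != 0 :> {poly C} by rewrite expf_neq0 // polyXsubC_eq0.
have : p * 'X * (e%:R * h + ('X - b%:P) * h^`())
    = ('X - b%:P) * (l *: h + h * 'X * p^`() + w%:R * p * h).
  apply: (mulfI X0).
  transitivity (p * 'X * (('X - b%:P) * q^`())); first by rewrite qD; ring.
  transitivity (('X - b%:P) * (l *: q + q * 'X * p^`() + w%:R * p * q)).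
    by rewrite -E; ring.
  by rewrite qE -mul_polyC -(mul_polyC l h); ring.
move/(congr1 (fun f : {poly C} => f.[b])).
rewrite -!polyC_natr.
rewrite !(hornerD, hornerN, hornerM, hornerZ, hornerX, hornerC).
rewrite subrr !(mul0r, mulr0, addr0, add0r, subr0).
move/eqP; rewrite !mulf_eq0 (negPf b0) (negPf h0) pnatr_eq0.
by rewrite eqn0Ngt e0 !orbF.
Qed.

(** A repeated factor would divide the derivative as well. *)
Lemma uniq_prod_XsubC s (p := \prod_(z <- s) ('X - z%:P)) :
  (forall a, root p a -> p^`().[a] != 0) -> uniq s.
Proof.
move=> pP; apply: count_mem_uniq => a.
have [as_|/count_memPn//] := boolP (a \in s).
have pa : root p a by rewrite root_prod_XsubC.
have [h [_ pE pD]] := prod_XsubC_local a s.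
have := pP a pa; have : (0 < count_mem a s)%N by rewrite -has_count has_pred1.
move: (count_mem a s) pE pD => [|[|e]] // pE pD _.
have X0 : 'X - a%:P != 0 :> {poly C} by rewrite polyXsubC_eq0.
have -> : p^`() = ('X - a%:P) ^+ e.+1 * (e.+2%:R * h + ('X - a%:P) * h^`()).
  by apply: (mulfI X0); rewrite pD exprS mulrA.
by rewrite exprS !hornerM hornerXsubC subrr !mul0r eqxx.
Qed.

(** Here p stands for P and q for t^w Q, and the last hypothesis is [P, Q] = l Q multiplied by t^w.
    At a root a of p with multiplicity e in q, [root_residue] gives (e - 1) a p'(a) = l; since l is
    nonzero, a is a simple root of p and e is not 1. The entries of [r] are the numbers e - 1. *)
Lemma pair_Sigma p q n w l : (0 < n)%N -> (0 < w)%N -> l != 0 ->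
  p \is monic -> size p = n.+1 -> p`_0 != 0 ->
  q \is monic -> size q = (n + w).+1 -> q`_0 != 0 ->
  size ('X^w * p - q) = w.+1 ->
  p * ('X * q^`() - w%:R * q) - q * ('X * p^`()) = l *: q ->
  exists k (r : 'rV[int]_n) (a : 'rV[C]_n),
    [/\ (0 < k)%N, (k <= n)%N, Gamma k r & Vr_unit r a] /\
    [/\ wt r = w, p = \prod_(j < n) ('X - (a 0 j)%:P)
      & q = \prod_(j < n | (j < k)%N) ('X - (a 0 j)%:P) ^+ absz (r 0 j + 1)%R].
Proof.
move=> n0 w0 l0 pm ps p0 qm qs q0 pq E.
have [rs] := closed_field_poly_normal p; rewrite (monicP pm) scale1r => p_rs.
have [s] := closed_field_poly_normal q; rewrite (monicP qm) scale1r => q_s.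
have res a : root p a -> ((count_mem a s)%:R - 1) * (a * p^`().[a]) = l.
  exact: root_residue E q_s.
have root_nz (f : {poly C}) a : f`_0 != 0 -> root f a -> a != 0.
  by move=> f0; apply: contraTneq => ->; rewrite /root horner_coef0.
have s_p a : a \in s -> root p a.
  move=> a_s; apply: (root_of_pair E q_s) => //.
  by apply: root_nz q0 _; rewrite q_s root_prod_XsubC.
have u_rs : uniq rs.
  apply: uniq_prod_XsubC => a; rewrite -p_rs => /res H.
  by apply: contra_neq l0 => p'a; rewrite -H p'a !mulr0.
(* The roots of p that are also roots of q come first, so that they are the entries of index j <
   k. *)
pose t := [seq a <- rs | a \in s] ++ [seq a <- rs | a \notin s].
have t_rs : perm_eq t rs by apply/permPl; exact: perm_filterC.
have p_t : p = \prod_(z <- t) ('X - z%:P) by rewrite p_rs (perm_big _ t_rs).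
have u_t : uniq t by rewrite (perm_uniq t_rs).
have root_t a : root p a = (a \in t) by rewrite p_t root_prod_XsubC.
have size_t : size t = n.
  by move: ps; rewrite p_t size_prod_XsubC => -[].
have size_s : size s = (n + w)%N.
  by move: qs; rewrite q_s size_prod_XsubC => -[].
have s_t : {subset s <= t} by move=> a /s_p; rewrite root_t.
pose k := size [seq a <- rs | a \in s].
pose a : 'rV[C]_n := \row_j t`_j.
pose r : 'rV[int]_n := \row_j ((count_mem t`_j s)%:Z - 1).
have big_t (R : Type) (idx : R) (op : Monoid.com_law idx) (F : C -> R) :
    \big[op/idx]_(z <- t) F z = \big[op/idx]_(j < n) F (a 0 j).
  rewrite (big_nth 0) size_t big_mkord; apply: eq_bigr => j _.
  by rewrite mxE.
have a_t (j : 'I_n) : a 0 j \in t by rewrite mxE mem_nth // size_t.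
have in_s (j : 'I_n) : (a 0 j \in s) = (j < k)%N.
  rewrite mxE nth_cat -/k; case: ltnP => jk.
    by have := mem_nth 0 jk; rewrite mem_filter => /andP[].
  have jk' : (j - k < size [seq a <- rs | a \notin s])%N.
    have := ltn_ord j; rewrite -[X in (_ < X)%N -> _]size_t size_cat -/k.
    by lia.
  by have := mem_nth 0 jk'; rewrite mem_filter => /andP[/negPf].
have rE j : r 0 j = (count_mem (a 0 j) s)%:Z - 1 by rewrite !mxE.
have res_r (j : 'I_n) : (r 0 j)%:~R * (a 0 j * p^`().[a 0 j]) = l.
  by rewrite -(@res (a 0 j)) ?root_t // rE rmorphB.
(* No a_j is thus a simple root of q: for j < k its multiplicity is at least 2, and r_j is
   positive. *)
have r0 j : r 0 j != 0.
  by apply: contra_neq l0 => rj; rewrite -(res_r j) rj mul0r.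
(* The multiplicities add up to the degree n + w of q, and 1 is subtracted n times. *)
have wt_r : wt r = w.
  have : (\sum_(z <- t) count_mem z s)%N = (n + w)%N.
    by rewrite sum_count_mem.
  rewrite big_t => H; rewrite /wt; under eq_bigr do rewrite rE.
  rewrite sumrB sumr_const card_ord -(big_morph Posz PoszD (erefl _)) H.
  by lia.
have k_w : (k <= w)%N.
  rewrite -ltnS -pq; apply: max_poly_roots.
  - by rewrite -size_poly_eq0 pq.
  - apply/allP => z; rewrite mem_filter => /andP[zs _].
    rewrite rootE hornerD hornerN hornerM.
    have /eqP-> := s_p z zs.
    have /eqP-> : root q z by rewrite q_s root_prod_XsubC.
    by rewrite mulr0 subr0.
  - exact: filter_uniq.
have pE : p = \prod_(j < n) ('X - (a 0 j)%:P) by rewrite {1}p_t big_t.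
exists k, r, a; split.
  split.
  (* For k = 0 the polynomial q would have no root, although its degree n + w is positive. *)
  - rewrite lt0n; apply/negP => /eqP k0.
    have : (0 < size s)%N by rewrite size_s addn_gt0 n0.
    case: (s) in_s s_t => // z s' in_s s_t _.
    have zt : z \in t by apply: s_t; rewrite mem_head.
    have zn : (index z t < n)%N by rewrite -size_t index_mem.
    have := in_s (Ordinal zn); rewrite mxE /= nth_index //.
    by rewrite mem_head k0.
  - by rewrite -size_t size_cat leq_addr.
  - split=> [j jk|j kj|]; last by rewrite wt_r.
      have : (0 < count_mem (a 0%R j) s)%N by rewrite -has_count has_pred1 in_s.
      by move: (r0 j); rewrite rE; lia.
    by rewrite rE (count_memPn _) // in_s -leqNgt.
  - split=> [i /andP[i1 iN]|j] /=; last by apply: root_nz p0 _; rewrite root_t.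
    have a_inj : injective (fun j => a 0 j).
      move=> i1' i2; rewrite !mxE => /eqP.
      by rewrite nth_uniq ?size_t // => /eqP/val_inj.
    have := @sum_expr_div_deriv n (fun j => a 0 j) i.-1 a_inj.
    rewrite -pE => H; have {}H := H ltac:(lia).
    (* By [res_r], r_j a_j^i = l a_j^(i-1) / p'(a_j), and i <= n - 1 is just the range in which the
       interpolation identity for the exponent i - 1 holds. *)
    transitivity (l * 0); last exact: mulr0.
    rewrite -[X in l * X]H mulr_sumr; apply: eq_bigr => j _.
    have pj0 : p^`().[a 0 j] != 0.
      by apply: contra_neq l0 => e; rewrite -(res_r j) e !mulr0.
    rewrite -[in RHS](res_r j) -{1}(prednK i1) exprS.
    by field.
split=> //.
rewrite {1}q_s -(prod_count_mem u_t s_t) big_t [RHS]big_mkcond /=.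
(* For j >= k the multiplicity is 0 and the factor is 1, so the restriction to j < k changes
   nothing. *)
apply: eq_bigr => j _; rewrite rE subrK -in_s.
by case: ifP => // /negbT/count_memPn ->.
Qed.

End PolynomialPair.

(** * Polynomials as Laurent polynomials, and the parameter of a [witt_pair] *)

Section LaurentOfPoly.
Context {C : numClosedFieldType}.
Implicit Types (p q : {poly C}) (f : laurent C) (m : int) (n w : nat).

Lemma lmonD m k : lmon (m + k) = lmon m * lmon k :> laurent C.
Proof. by rewrite [RHS]lmulUU mul1r. Qed.

Lemma lmon1X n : lmon 1 ^+ n = lmon n :> laurent C.
Proof. by elim: n => // n IH; rewrite exprS IH -lmonD. Qed.

Lemma lmonI m : injective (fun f : laurent C => lmon m * f).
Proof.
apply: (can_inj (g := fun f => lmon (- m) * f)) => f.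
by rewrite mulrA -lmonD addNr mul1r.
Qed.

Lemma mcoeff_lmonM m f k : (lmon m * f)@_k = f@_(k - m).
Proof.
rewrite mcoeff_lmul msuppU oner_eq0 big_seq_fset1.
by rewrite mcoeff_lmon eqxx mul1r.
Qed.

(** Evaluation at t, chosen so that products and differences are preserved by construction. *)
Definition laurent_of_poly p : laurent C := horner_alg (lmon 1) p.
Local Notation phi := laurent_of_poly.

Lemma laurent_of_polyE p : phi p = \sum_(i < size p) p`_i *: lmon i.
Proof.
rewrite /phi -{1}[p]coefK poly_def linear_sum; apply: eq_bigr => i _.
by rewrite linearZ rmorphXn /= horner_algX lmon1X mulr_algl.
Qed.

Lemma mcoeff_laurent_of_poly p n : (phi p)@_n%:Z = p`_n.
Proof.
rewrite laurent_of_polyE raddf_sum /=.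
under eq_bigr do rewrite mcoeffZ mcoeff_lmon.
have [np|np] := ltnP n (size p).
  rewrite (bigD1 (Ordinal np)) //= eqxx mulr1 big1 ?addr0 // => i ij.
  rewrite eqz_nat; case: eqP => [e|_]; last by rewrite mulr0.
  by case/eqP: ij; apply: val_inj.
rewrite nth_default // big1 // => i _.
by rewrite eqz_nat ltn_eqF ?mulr0 // (leq_trans (ltn_ord i)).
Qed.

Lemma mcoeff_laurent_of_poly_lt0 p m : m < 0 -> (phi p)@_m = 0.
Proof.
move=> m0; rewrite laurent_of_polyE raddf_sum /= big1 // => i _.
by rewrite mcoeffZ mcoeff_lmon gt_eqF ?mulr0 //; lia.
Qed.

Lemma laurent_of_poly_inj : injective phi.
Proof.
by move=> p q pq; apply/polyP => i; rewrite -!mcoeff_laurent_of_poly pq.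
Qed.

Lemma lder_laurent_of_poly p : lder (phi p) = phi ('X * p^`()).
Proof.
apply/malgP => m; rewrite mcoeff_lder; case: m => n.
  rewrite !mcoeff_laurent_of_poly coefXM; case: n => [|n]; first by rewrite mulr0.
  by rewrite coef_deriv mulr_natr.
by rewrite !mcoeff_laurent_of_poly_lt0 ?mul0r.
Qed.

Lemma laurent_of_poly_eq p f : (forall m, m < 0 -> f@_m = 0) ->
  (forall n, p`_n = f@_n%:Z) -> phi p = f.
Proof.
move=> f0 pf; apply/malgP => -[n|n]; first by rewrite mcoeff_laurent_of_poly.
by rewrite f0 ?mcoeff_laurent_of_poly_lt0.
Qed.

Lemma laurent_of_polyM p q : phi (p * q) = phi p * phi q.
Proof. exact: rmorphM. Qed.

Lemma laurent_of_polyB p q : phi (p - q) = phi p - phi q.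
Proof. exact: rmorphB. Qed.

Lemma laurent_of_polyXsubC a : phi ('X - a%:P) = lmon 1 - a%:A.
Proof. by rewrite /phi rmorphB /= horner_algX horner_algC. Qed.

Lemma size_polyS p n : p`_n != 0 -> (forall i, (n < i)%N -> p`_i = 0) ->
  size p = n.+1.
Proof.
move=> pn pi; apply/eqP; rewrite eqn_leq; apply/andP; split.
  by apply/leq_sizeP => i; exact: pi.
by rewrite ltnNge; apply: contra pn => h; rewrite nth_default.
Qed.

(** The polynomial [p] is P itself and [q] is t^w Q, without pole; the normalisation of a
    [witt_pair] turns into monicity, degrees and nonzero constant terms. *)
Lemma witt_pair_Sigma n w l (P Q : laurent C) : witt_pair n w l P Q ->
  exists mu : Sigma C, P_ mu = P /\ Q_ mu = Q.
Proof.
case=> n0 w0 l0 Plo Phi P1 Qlo Qhi Q1 PQ br.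
pose p := \poly_(i < n.+1) P@_i%:Z.
pose q := \poly_(i < (n + w).+1) Q@_(i%:Z - w%:Z).
have pc i : p`_i = P@_i%:Z.
  by rewrite coef_poly; case: ltnP => // h; rewrite Phi.2 // /beyond; lia.
have qc i : q`_i = Q@_(i%:Z - w%:Z).
  by rewrite coef_poly; case: ltnP => // h; rewrite Qhi.2 // /beyond; lia.
have ps : size p = n.+1.
  apply: size_polyS => [|i h]; rewrite pc; first by rewrite P1 oner_eq0.
  by rewrite Phi.2.
have qn : (n + w)%N%:Z - w%:Z = n by lia.
have qs : size q = (n + w).+1.
  apply: size_polyS => [|i h]; rewrite qc; first by rewrite qn Q1 oner_eq0.
  by rewrite Qhi.2 // /beyond; lia.
have pm : p \is monic by rewrite monicE lead_coefE ps pc P1.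
have qm : q \is monic by rewrite monicE lead_coefE qs qc qn Q1.
have PE : P = phi p.
  by apply/esym/laurent_of_poly_eq => // m m0; exact: Plo.2.
have QE : Q = lmon (- w%:Z) * phi q.
  apply/malgP => m; rewrite mcoeff_lmonM opprK.
  have [h|h] := ltP m (- w%:Z).
    by rewrite mcoeff_laurent_of_poly_lt0 ?[LHS]Qlo.2 //; lia.
  have -> : m + w = absz (m + w) by lia.
  by rewrite mcoeff_laurent_of_poly qc; congr (Q@_ _); lia.
have pqs : size ('X^w * p - q) = w.+1.
  have c i : ('X^w * p - q)`_i = (P - Q)@_(i%:Z - w%:Z).
    rewrite coefB coefXnM qc mcoeffB; congr (_ - _); case: ltnP => h.
      by rewrite Plo.2 // /beyond; lia.
    by rewrite pc; congr (P@_ _); lia.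
  apply: size_polyS => [|i h]; rewrite c; first by rewrite subrr; exact: PQ.1.
  by rewrite PQ.2 // /beyond; lia.
(* Stated over an abstract ring: [ring] does not terminate on [laurent C]. *)
have ringE (T : comNzRingType) (t u v u' v' c : T) :
    t * (u * (v' - c * v) - v * u') = u * (t * - c * v + t * v') - t * v * u'.
  by ring.
have E : p * ('X * q^`() - w%:R * q) - q * ('X * p^`()) = l *: q.
  apply: laurent_of_poly_inj; apply: (@lmonI (- w%:Z)).
  have -> : lmon (- w%:Z) * phi (l *: q) = l *: Q.
    by rewrite /phi linearZ /= mulr_algl QE scalerAr.
  rewrite -br /witt_bracket {1 2}QE lderM lder_lmon PE !lder_laurent_of_poly.
  (* The derivative of the factor t^(-w) produces the term - w q of [E]. *)
  have -> : lterm (- w%:Z)%:~R (- w%:Z) = lmon (- w%:Z) * - phi w%:R.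
    rewrite /phi rmorph_nat -[X in lterm X _]mulr1 -ltermZ scaler_int.
    by rewrite mulrNz mulrN mulr_natr.
  rewrite laurent_of_polyB (laurent_of_polyM p) (laurent_of_polyM q).
  by rewrite laurent_of_polyB (laurent_of_polyM w%:R) ringE.
have [] := pair_Sigma n0 w0 l0 pm ps _ qm qs _ pqs E.
- by rewrite pc Plo.1.
- by rewrite qc sub0r Qlo.1.
move=> k [r [a [[k0 kn rG aV] [wtE pE qE]]]].
exists (MkSigma n0 k0 kn rG aV); split.
  rewrite /P_ /= PE pE /phi rmorph_prod /=; apply: eq_bigr => j _.
  exact/esym/laurent_of_polyXsubC.
rewrite /Q_ /= QE wtE qE /phi rmorph_prod /=; congr (_ * _).
apply: eq_bigr => j _.
by rewrite rmorphXn -laurent_of_polyXsubC.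
Qed.

End LaurentOfPoly.

(** * Spans in the Virasoro algebra and their images modulo K *)

Section Lift.
Context {C : numClosedFieldType}.
Implicit Types (x y : vir C) (ts : seq (laurent C)) (xs : seq (vir C)) (m : int).

Lemma vir_bracket_fst x x' y y' : x.1 = x'.1 -> y.1 = y'.1 ->
  vir_bracket x y = vir_bracket x' y'.
Proof. by rewrite /vir_bracket => -> ->. Qed.

Lemma lspan_vec ts x : lspan (map vec ts) x <-> lspan ts x.1 /\ x.2 = 0.
Proof.
elim: ts x => [|t ts IH] [f c].
  split=> [/lspan_nil[-> ->]|[/lspan_nil /= -> /= ->]]; last exact/lspan_nil.
  by split=> //; exact/lspan_nil.
split=> [/lspan_cons[a /IH[/= h e]]|[/lspan_cons[a /= h] e]].
  split; first by apply/lspan_cons; exists a.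
  by move: e; rewrite scaler0 subr0.
apply/lspan_cons; exists a; apply/IH; split=> //=.
by rewrite e scaler0 subr0.
Qed.

Lemma lspan_fst xs f : lspan (map fst xs) f -> exists2 x, lspan xs x & x.1 = f.
Proof.
elim: xs f => [|x xs IH] f.
  by move/lspan_nil->; exists 0 => //; apply/lspan_nil.
move=> /lspan_cons[a /IH[y ys yE]]; exists (a *: x + y).
  by apply/lspan_cons; exists a; rewrite addrAC subrr add0r.
by rewrite /= yE addrC subrK.
Qed.

Lemma fst_lspan xs x : lspan xs x -> lspan (map fst xs) x.1.
Proof.
elim: xs x => [|y xs IH] x; first by move/lspan_nil->; apply/lspan_nil.
by move=> /lspan_cons[a /IH h]; apply/lspan_cons; exists a.
Qed.

Lemma lfree_behead (V : lmodType C) (t : V) s : lfree (t :: s) -> lfree s.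
Proof.
move=> fs c e; have := fs (fun i => if unlift ord0 i is Some j then c j else 0).
rewrite big_ord_recl unlift_none scale0r add0r /=.
under eq_bigr do rewrite liftK.
by move=> /(_ e) h i; have := h (lift ord0 i); rewrite liftK.
Qed.

Lemma lfree_head (V : lmodType C) (t : V) s c :
  lfree (t :: s) -> lspan s (c *: t) -> c = 0.
Proof.
move=> fs [d e].
have := fs (fun i => if unlift ord0 i is Some j then - d j else c).
rewrite big_ord_recl unlift_none /= => h; have := h _ ord0.
rewrite unlift_none; apply.
under eq_bigr do rewrite liftK scaleNr.
by rewrite sumrN e subrr.
Qed.

Lemma lfree_fst xs : lfree (map fst xs) -> lfree xs.
Proof.
elim: xs => [|x xs IH] fs; first exact: lfree_nil.
apply: lfree_cons => [|c h]; first exact/IH/(lfree_behead fs).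
by apply: (lfree_head fs); exact: (fst_lspan h).
Qed.

Lemma map_fst_vec ts : map fst (map vec ts) = ts.
Proof. by rewrite -map_comp map_id. Qed.

Lemma lfree_cons_vK ts : lfree ts -> lfree (vK :: map vec ts).
Proof.
move=> fts; apply: lfree_cons; first by apply: lfree_fst; rewrite map_fst_vec.
by move=> c /lspan_vec[_ /=]; rewrite [_ *: _]mulr1.
Qed.

(** Serves to pass from [lmon m] to [- lmon m], the first component of [L m]. *)
Lemma lspan_opp (V : lmodType C) (s : seq V) : lspan (map -%R s) = lspan s.
Proof.
apply: (@lspan_eq _ _ _ s (lspan_submod _)) => [x xs|].
  rewrite -[x]opprK -scaleN1r; apply: submodZ (lspan_submod _) _.
  by apply: mem_lspan; exact: map_f.
apply: sub_lspan (lspan_submod _) _ => _ /mapP[x xs ->].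
by rewrite -scaleN1r; apply: submodZ (lspan_submod _) _; exact: mem_lspan.
Qed.

Lemma lspan_rot (V : lmodType C) (x y z t : V) :
  lspan [:: t; x; y; z] = lspan [:: x; y; z; t].
Proof.
have E u : (u \in [:: t; x; y; z]) = (u \in [:: x; y; z; t]).
  by rewrite !inE [LHS]orbC -!orbA.
apply: lspan_eq (lspan_submod _) _ _ => [u|].
  by rewrite -E; exact: mem_lspan.
by apply: sub_lspan (lspan_submod _) _ => u; rewrite E; exact: mem_lspan.
Qed.

Lemma lfree1 (f : laurent C) : f != 0 -> lfree [:: f].
Proof.
move=> /(ext_exists true)[m fm]; apply: (lfree_cons_ext (m := m)) fm.1 _ => //.
exact: lfree_nil.
Qed.

Lemma lfree2 (f g : laurent C) m : f@_m != 0 -> g@_m = 0 -> g != 0 ->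
  lfree [:: f; g].
Proof.
move=> fm gm g0; apply: (lfree_cons_ext (m := m)) fm _; first exact: lfree1.
by move=> h; rewrite inE => /eqP->.
Qed.

Lemma lmon_neq0 m : lmon m != 0 :> laurent C.
Proof. exact: ext_neq0 (ext_lmonP true m). Qed.

Lemma mcoeff_lmon_neq m n : m != n -> (lmon m : laurent C)@_n = 0.
Proof. by rewrite mcoeff_lmon => /negPf->. Qed.

Lemma lfree_lmon2 m : m != 0 -> lfree [:: lmon 0; lmon m : laurent C].
Proof.
move=> m0; apply: (@lfree2 _ _ 0); last exact: lmon_neq0.
  exact: (ext_lmonP true 0).1.
exact: mcoeff_lmon_neq.
Qed.

Lemma lfree_lmon3 m : 0 < m ->
  lfree [:: lmon 0; lmon (- m); lmon m : laurent C].
Proof.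
move=> m0; apply: (lfree_cons_ext (m := 0)).
- apply: (@lfree2 _ _ (- m)); last exact: lmon_neq0.
    exact: (ext_lmonP true (- m)).1.
  by apply: mcoeff_lmon_neq; lia.
- exact: (ext_lmonP true 0).1.
- by move=> y; rewrite !inE => /orP[]/eqP->; apply: mcoeff_lmon_neq; lia.
Qed.

(** Only Q has a term of degree -w, so a multiple of P that lies on the line of Q is zero. *)
Lemma lfree_pair n w l (P Q : laurent C) : witt_pair n w l P Q ->
  lfree [:: P; Q].
Proof.
case=> n0 w0 _ Plo _ _ Qlo _ _ _ _.
have Pw : P@_(- w%:Z) = 0 by apply: Plo.2; rewrite /beyond; lia.
apply: lfree_cons => [|c]; first exact: lfree1 (ext_neq0 Qlo).
move=> /lspan_cons[b /lspan_nil/eqP]; rewrite subr_eq0 => /eqP E.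
have := congr1 (fun f : laurent C => f@_(- w%:Z)) E.
rewrite !mcoeffZ Pw mulr0 => /esym/eqP; rewrite mulf_eq0 (negPf Qlo.1) orbF.
move/eqP=> b0; move: E; rewrite b0 scale0r => /eqP.
by rewrite scaler_eq0 (negPf (ext_neq0 Plo)) orbF => /eqP.
Qed.

(** * Virasoro subalgebras over their images in the Witt algebra *)

Section Projection.
Variable A : set (vir C).
Hypothesis lieA : is_lie_subalgebra A.
Let lA := lieA.1.

Definition witt_image : set (laurent C) :=
  [set f | exists c, A (f, c)]%classic.

Lemma witt_image_fst x : A x -> witt_image x.1.
Proof. by case: x => f c Ax; exists c. Qed.

Lemma witt_image_subalgebra : witt_subalgebra witt_image.
Proof.
split; first split.
- by apply/mem_set; exists 0; exact: (submod0 lA).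
- move=> a f g /set_mem[c Af] /set_mem[b Ag]; apply/mem_set.
  by exists (a *: c + b); exact: (submodP lA a Af Ag).
- by move=> f g [c Af] [b Ag]; exists (vir_cocycle f g); exact: (lieA.2 _ _ Af Ag).
Qed.

Lemma witt_image_bounded d : has_dim A d -> bounded witt_image.
Proof.
move=> [s [_ _ As]]; have [N NP] := lspan_bounded (map fst s).
by exists N => f [c]; rewrite As => /fst_lspan; exact: NP.
Qed.

(** Adding multiples of K adjusts the second component at will, so [A] is the full preimage of its
    image. *)
Lemma central_mem x : A vK -> A x <-> witt_image x.1.
Proof.
move=> AK; split; first exact: witt_image_fst.
case: x => f c [b Af]; rewrite [(f, c)](_ : _ = (c - b) *: vK + (f, b)).
  exact: submodP.
by congr pair; rewrite /= ?scaler0 ?add0r // [_ *: _]mulr1 subrK.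
Qed.

Lemma central_span ts : A vK -> witt_image = lspan ts ->
  A = lspan (vK :: map vec ts).
Proof.
move=> AK Bts; apply: lspan_eq => // x.
  rewrite inE => /orP[/eqP-> //|/mapP[t tts ->]].
  by apply/central_mem => //=; rewrite Bts; exact: mem_lspan.
move=> /witt_image_fst; rewrite Bts => h; apply/lspan_cons; exists x.2.
apply/lspan_vec; rewrite /= scaler0 subr0; split=> //.
by rewrite [_ *: _]mulr1 subrr.
Qed.

Lemma central_direct_sum ts : A vK -> witt_image = lspan ts ->
  is_direct_sum A (lspan (map vec ts)) (lspan [:: vK]).
Proof.
move=> AK Bts; split; apply/seteqP; split=> x /=.
- move=> [/lspan_vec[_ x2] /lspan_cons[a /lspan_nil/eqP]].
  rewrite subr_eq0 => /eqP xE; move: x2; rewrite xE /= [_ *: _]mulr1 => ->.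
  exact: scale0r.
- by move=> ->; split; exact: (submod0 (lspan_submod _)).
- rewrite {1}(central_span AK Bts) => /lspan_cons[a h].
  exists (x - a *: vK) => //; exists (a *: vK); last by rewrite subrK.
  by apply: submodZ (lspan_submod _) _; apply: mem_lspan; exact: mem_head.
- move=> [y /lspan_vec[ys _] [z /lspan_cons[a /lspan_nil/eqP]]].
  rewrite subr_eq0 => /eqP -> <-; apply/central_mem => //=.
  by rewrite scaler0 addr0 Bts.
Qed.

(** The difference is a multiple of K in [A], hence zero: [A] is a graph over its image. *)
Lemma noncentral_uniq x y : ~ A vK -> A x -> A y -> x.1 = y.1 -> x = y.
Proof.
case: x y => f c [g b] noK Ax Ay /= fg; subst g; congr pair; apply/eqP.
rewrite -subr_eq0; apply/negPn/negP => cb; apply: noK.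
apply: (submodZV lA cb); rewrite (_ : _ *: _ = -1 *: (f, b) + (f, c)).
  exact: submodP.
by congr pair; rewrite /= ?scaler0 scaleN1r addrC ?subrr // [LHS]mulr1.
Qed.

Lemma noncentral_span xs : ~ A vK -> (forall x, x \in xs -> A x) ->
  witt_image = lspan (map fst xs) -> A = lspan xs.
Proof.
move=> noK xsA Bxs; apply: lspan_eq => // x Ax.
have := witt_image_fst Ax; rewrite Bxs => /lspan_fst[y ys yx].
by rewrite (noncentral_uniq noK Ax (sub_lspan lA xsA ys) (esym yx)).
Qed.

Lemma central_dim d ts : has_dim A d -> A vK -> lfree ts ->
  witt_image = lspan ts -> d = (size ts).+1.
Proof.
move=> dA AK fts /(central_span AK) AE.
by rewrite (has_dim_uniq dA (lfree_cons_vK fts) AE) /= size_map.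
Qed.

(** Lifts to [A] of a basis of the image are free, and they span [A] because the projection is
    injective on it. *)
Lemma noncentral_dim d ts : has_dim A d -> ~ A vK -> lfree ts ->
  witt_image = lspan ts -> d = size ts.
Proof.
move=> dA noK fts Bts.
have [xs xsA xsE] : exists2 xs, (forall x, x \in xs -> A x) & map fst xs = ts.
  have : forall t, t \in ts -> witt_image t.
    by move=> t; rewrite Bts; exact: mem_lspan.
  elim: (ts) => [|t ts' IH] tsB; first by exists [::].
  have [|xs xsA xsE] := IH; first by move=> u uts; apply: tsB; rewrite inE uts orbT.
  have [c Atc] := tsB t (mem_head _ _).
  exists ((t, c) :: xs); last by rewrite /= xsE.
  by move=> x; rewrite inE => /orP[/eqP->|/xsA].
rewrite -xsE size_map; apply: has_dim_uniq dA _ _.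
  by apply: lfree_fst; rewrite xsE.
by apply: noncentral_span => //; rewrite xsE.
Qed.

(** The lifts of L_0 and L_m are known only up to multiples of K, but their bracket is exactly -m
    L_m, as the cocycle pairs opposite degrees only. *)
Lemma L_mem m : m != 0 -> witt_image (- lmon 0) -> witt_image (- lmon m) ->
  A (L m).
Proof.
move=> m0 [a A0] [b Am]; have := lieA.2 _ _ A0 Am.
rewrite (@vir_bracket_fst _ (L 0) _ (L m)) // vir_bracketLL sub0r add0r.
have /negPf -> : 0 != - m by lia.
rewrite mul0r scale0r addr0.
have c0 : (- m)%:~R != 0 :> C by rewrite intr_eq0; lia.
exact: (submodZV lA c0).
Qed.

(** Dividing [L_m, L_{-m}] = 2m L_0 + (m^3 - m)/12 K by 2m gives the constant (m^2 - 1)/24. *)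
Lemma L0_mem m : m != 0 -> A (L m) -> A (L (- m)) ->
  A (L 0 + ((m ^+ 2 - 1)%:~R / 24%:R) *: vK).
Proof.
move=> m0 Am ANm; have := lieA.2 _ _ Am ANm.
rewrite vir_bracketLL subrr opprK eqxx mul1r => h.
have m0' : (m + m)%:~R != 0 :> C by rewrite intr_eq0; lia.
apply: (submodZV lA m0'); rewrite scalerDr scalerA.
have -> // : (m + m)%:~R * ((m ^+ 2 - 1)%:~R / 24)
             = (m ^+ 3 - m)%:~R / 12 :> C.
by rewrite !(rmorphD, rmorphB, rmorphXn) /=; field.
Qed.

(** A generator that is a bracket of members up to a nonzero scalar has a determined K-component:
    this holds for L_m and Q, and for L_0 once L_m and L_{-m} are both present. Otherwise the
    component is the free [alpha]. *)
Lemma noncentral_cases d : has_dim A d -> ~ A vK ->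
  [\/ (d <= 1)%N,
      d = 2 /\
      ((exists alpha m, m != 0 /\ A = lspan [:: L 0 + alpha *: vK; L m]) \/
       exists (mu : Sigma C) (alpha beta0 lambda : C),
       [/\ lambda != 0,
           vir_bracket (vec (P_ mu)) (vec (Q_ mu))
           = lambda *: vec (Q_ mu) + (lambda * beta0) *: vK
         & A = lspan [:: vec (P_ mu) + alpha *: vK;
                         vec (Q_ mu) + beta0 *: vK]])
    | d = 3 /\ exists2 m,
        m != 0 & A = lspan [:: L 0 + ((m ^+ 2 - 1)%:~R / 24%:R) *: vK;
                               L (- m); L m]].
Proof.
move=> dA noK.
have dim ts : lfree ts -> witt_image = lspan ts -> d = size ts.
  exact: noncentral_dim.
have Bmem ts f : witt_image = lspan ts -> f \in ts -> witt_image f.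
  by move=> ->; exact: mem_lspan.
have [Bts|[[f f0 Bts]|[[m m0 Bts]|[[n [w [l [P [Q [PQ Bts]]]]]]|[m m0 Bts]]]]]
  := witt_classification witt_image_subalgebra (witt_image_bounded dA).
- by apply: Or31; rewrite (dim _ (@lfree_nil _ _) Bts).
- by apply: Or31; rewrite (dim _ (lfree1 f0) Bts).
- apply: Or32; split; first by rewrite (dim _ (lfree_lmon2 m0) Bts).
  left; rewrite -lspan_opp /= in Bts.
  have A0 : witt_image (- lmon 0) by apply: Bmem Bts _; exact: mem_head.
  have Am : A (L m).
    by apply: L_mem => //; apply: Bmem Bts _; exact: mem_snd.
  have [a A0a] := A0; exists a, m; split=> //.
  have E : L 0 + a *: vK = (- lmon 0, a).
    by congr pair; rewrite /= ?scaler0 ?addr0 // add0r [_ *: _]mulr1.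
  apply: (noncentral_span noK).
    by move=> x; rewrite !inE => /orP[]/eqP->; rewrite ?E; [exact: A0a|exact: Am].
  by rewrite E.
- apply: Or32; split; first by rewrite (dim _ (lfree_pair PQ) Bts).
  right; have [mu [PE QE]] := witt_pair_Sigma PQ; subst P Q.
  have [a AP] : witt_image (P_ mu) by apply: Bmem Bts _; exact: mem_head.
  have [b AQ] : witt_image (Q_ mu) by apply: Bmem Bts _; exact: mem_snd.
  (* As [P, Q] = l Q + c K in the Virasoro algebra, [beta0] has to be c / l. *)
  have l0 := wp_l PQ; pose c := vir_cocycle (P_ mu) (Q_ mu).
  have E (f : laurent C) e : vec f + e *: vK = (f, e).
    by congr pair; rewrite /= ?scaler0 ?addr0 // add0r [_ *: _]mulr1.
  have brE : vir_bracket (vec (P_ mu)) (vec (Q_ mu))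
             = l *: vec (Q_ mu) + (l * (c / l)) *: vK.
    rewrite mulrC divfK // -[l *: vec _]/(l *: Q_ mu, l * 0).
    rewrite mulr0 -(wp_br PQ).
    by rewrite -[(_, 0)]/(vec _) E.
  exists mu, a, (c / l), l; split; [exact: l0|exact: brE|].
  apply: (noncentral_span noK).
    move=> x; rewrite !inE => /orP[]/eqP->; rewrite E; first exact: AP.
    (* Whatever [b] is, the bracket of the lifts of P and Q is l (Q + (c / l) K). *)
    have := lieA.2 _ _ AP AQ.
    rewrite (@vir_bracket_fst _ (vec (P_ mu)) _ (vec (Q_ mu))) // brE.
    by rewrite -scalerA -scalerDr E => /(submodZV lA l0).
  by rewrite !E.
- apply: Or33; split; first by rewrite (dim _ (lfree_lmon3 m0) Bts).
  rewrite -lspan_opp /= in Bts.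
  have mn0 : m != 0 by lia.
  have Am : A (L m).
    by apply: L_mem => //; apply: Bmem Bts _; [exact: mem_head|exact: mem_trd].
  have ANm : A (L (- m)).
    apply: L_mem; rewrite ?oppr_eq0 //; apply: Bmem Bts _.
      exact: mem_head.
    exact: mem_snd.
  exists m; [exact: mn0|apply: (noncentral_span noK)].
    move=> x; rewrite !inE => /or3P[]/eqP->; last exact: Am.
      exact: L0_mem.
    exact: ANm.
  by rewrite /= scaler0 addr0.
Qed.

(** The dimension exceeds that of the image by one, so image dimensions 0 to 3 give 1 to 4. *)
Lemma central_cases d : has_dim A d -> A vK ->
  [\/ (d <= 1)%N,
      d = 2 /\ exists2 F : laurent C,
        F != 0 & is_direct_sum A (lspan [:: vec F]) (lspan [:: vK]),
      d = 3 /\ ((exists2 m,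
         m != 0 & is_direct_sum A (z_ m) (lspan [:: vK])) \/
       exists mu : Sigma C, is_direct_sum A (s_ mu) (lspan [:: vK]))
    | d = 4 /\ exists2 m, m != 0 & A = lspan [:: L 0; L (- m); L m; vK]].
Proof.
move=> dA AK.
have dim ts : lfree ts -> witt_image = lspan ts -> d = (size ts).+1.
  exact: central_dim.
have [Bts|[[f f0 Bts]|[[m m0 Bts]|[[n [w [l [P [Q [PQ Bts]]]]]]|[m m0 Bts]]]]]
  := witt_classification witt_image_subalgebra (witt_image_bounded dA).
- by apply: Or41; rewrite (dim _ (@lfree_nil _ _) Bts).
- apply: Or42; split; first by rewrite (dim _ (lfree1 f0) Bts).
  by exists f => //; exact: (central_direct_sum AK Bts).
- apply: Or43; split; first by rewrite (dim _ (lfree_lmon2 m0) Bts).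
  by left; exists m => //; exact: (central_direct_sum AK Bts).
- apply: Or43; split; first by rewrite (dim _ (lfree_pair PQ) Bts).
  right; have [mu [PE QE]] := witt_pair_Sigma PQ; subst P Q.
  by exists mu; exact: (central_direct_sum AK Bts).
- apply: Or44; split; first by rewrite (dim _ (lfree_lmon3 m0) Bts).
  exists m; first by lia.
  rewrite -lspan_opp /= in Bts; rewrite (central_span AK Bts).
  by apply: lspan_rot.
Qed.

End Projection.
End Lift.

Theorem theorem4p1 (R : realType) (A : set (vir R[i])) (d : nat)
    (A_lie : is_lie_subalgebra A) (A_dim : has_dim A d) :
  [/\ (d <= 4)%N,
      d = 1%N ->
        exists2 X : vir R[i], X != 0 & A = lspan [:: X],
      d = 2%N ->
        [\/ exists2 F : laurent R[i],
              F != 0 & is_direct_sum A (lspan [:: vec F]) (lspan [:: vK]),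
            exists (alpha : R[i]) (m : int),
              m != 0 /\ A = lspan [:: L 0 + alpha *: vK; L m]
          | exists (mu : Sigma R[i]) (alpha beta0 lambda : R[i]),
              [/\ lambda != 0,
                  vir_bracket (vec (P_ mu)) (vec (Q_ mu))
                  = lambda *: vec (Q_ mu) + (lambda * beta0) *: vK
                & A = lspan [:: vec (P_ mu) + alpha *: vK;
                                vec (Q_ mu) + beta0 *: vK]]],
      d = 3%N ->
        [\/ exists2 m : int,
              m != 0 & A = lspan [:: L 0 + ((m ^+ 2 - 1)%:~R / 24%:R) *: vK;
                                     L (- m); L m],
            exists2 m : int,
              m != 0 & is_direct_sum A (z_ m) (lspan [:: vK])
          | exists mu : Sigma R[i],
              is_direct_sum A (s_ mu) (lspan [:: vK])]
    & d = 4%N ->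
        exists2 m : int,
          m != 0 & A = lspan [:: L 0; L (- m); L m; vK]].
Proof.
(* This clause is read off a basis, whether or not [A] contains K. *)
have dim1 : d = 1%N -> exists2 X : vir R[i], X != 0 & A = lspan [:: X].
  move=> d1; have [[|X [|? ?]] [sd fs As]] := A_dim; rewrite ?d1 // in sd *.
  exists X => //; apply/eqP => X0.
  have := fs (fun=> 1); rewrite big_ord1 /= X0 scaler0 => /(_ erefl ord0)/eqP.
  by rewrite oner_eq0.
have [AK|noK] := pselect (A vK).
  case: (central_cases A_lie A_dim AK) => [d1|[d2 H]|[d3 H]|[d4 H]].
  - by split=> //; [lia|lia|lia|lia].
  - by subst d; split=> // _; exact: Or31.
  - subst d; split=> // _; case: H => H; [exact: Or32|exact: Or33].
  - by subst d; split.
case: (noncentral_cases A_lie A_dim noK) => [d1|[d2 H]|[d3 H]].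
- by split=> //; [lia|lia|lia|lia].
- subst d; split=> // _; case: H => H; [exact: Or32|exact: Or33].
- by subst d; split=> // _; exact: Or31.
Qed.
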